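(* Let $\exp^*\in\mathsf{G}_{\operatorname{PreLie}}$ be the element corresponding to $\sum_{k\ge1}\frac{v^{\leftarrow k}}{k!}$ in the completed free pre-Lie algebra on one generator $v$, let $\log^*$ be its inverse in the group $\mathsf{G}_{\operatorname{PreLie}}$, and let $\phi:\mathsf{G}_{\operatorname{PreLie}}\to\mathsf{G}_{\operatorname{As}}$ be the group morphism induced by the quotient map of operads $\operatorname{PreLie}\to\operatorname{As}$ killing non-linear trees. Identifying $\mathsf{G}_{\operatorname{As}}$ with the group of composition-invertible formal power series in $x\mathbb{Q}[[x]]$, the image of $\exp^*$ by $\phi$ is $\exp x-1$ and the image of $\log^*$ by $\phi$ is $\log(1+x)$.
   Context: Groups attached to operads. An augmented operad is a (symmetric, unital) operad $\mathcal{P}$ in $\mathbb{Q}$-vector spaces with $\mathcal{P}(0)=\{0\}$ and $\mathcal{P}(1)=\mathbb{Q}e$, where $e$ is the unit. Let $\gamma$ be its composition map, $\langle\,\cdot\,\rangle$ the quotient map to coinvariants $\mathcal{P}(n)_{\mathfrak{S}_n}$, and $\widehat{\mathcal{P}}=\prod_{n\ge1}\mathcal{P}(n)_{\mathfrak{S}_n}$. For $x=\sum_m x_m$, $y=\sum_n y_n$ in $\widehat{\mathcal{P}}$ with representatives $\bar{x}_m,\bar{y}_n$ of their components in $\mathcal{P}$, put $$x\times y=\sum_{m\ge1}\ \sum_{n_1,\dots,n_m\ge1}\langle\gamma(\bar{x}_m,\bar{y}_{n_1},\dots,\bar{y}_{n_m})\rangle .$$ This makes $\widehat{\mathcal{P}}$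 an associative monoid with unit the image of $e$, and $\mathsf{G}_{\mathcal{P}}$ is its group of invertible elements. A morphism of augmented operads induces a group morphism on the $\mathsf{G}$'s. The operad $\operatorname{PreLie}$. $\operatorname{PreLie}(n)$ has basis the rooted trees with vertices labeled bijectively by $\{1,\dots,n\}$ (and $\operatorname{PreLie}(0)=0$); edges are oriented towards the root. The composition of a labeled tree $S$ at the vertex $i$ of a labeled tree $T$ is $T\circ_i S=\sum_f T\circ_i^f S$, over all maps $f$ from the incoming edges of $i$ in $T$ to the vertices of $S$, where $T\circ_i^fS$ is obtained by replacing $i$ by $S$ and grafting back the subtrees of $T$ attached to $i$ according to $f$. Hence $\operatorname{PreLie}(n)_{\mathfrak{S}_n}$ has basis the unlabeled rooted trees with $n$ vertices, and $\bigoplus_n\operatorname{PreLie}(n)_{\mathfrak{S}_n}$ is identified with the free pre-Lie algebra on one generator $v$ (the one-vertex tree), with pre-Lie product $S\leftarrow T$ equal to the sum, over vertices $s$ of $S$, of the trees obtained by grafting the root of $T$ onto $s$ by a new edge. Here $v^{\leftarrow k}=((\cdots((v\leftarrow v)\leftarrow v)\cdots)\leftarrow v)$ with $k$ factors. The identification for $\operatorname{As}$. A rooted tree is linear if every vertex has at most one incoming edge. The span of non-linear labeled trees is an operadic ideal of $\operatorname{PreLie}$ and the quotient is the associative operad $\operatorname{As}$. The space $\operatorname{As}(n)_{\mathfrak{S}_n}$ is one-dimensional, with basis $\theta_n$, the image of the linear tree with $n$ vertices. The linear map $x^n\mapsto\theta_n$ is an isomorphism of monoids from $x\mathbb{Q}[[x]]$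 (with composition) to $\widehat{\operatorname{As}}$ (with $\times$); it gives the identification of $\mathsf{G}_{\operatorname{As}}$ used in the claim. *)

(* Defs.v *)
(* MathComp, with the classical axioms of mathcomp.classical.boolp. *)
From HB Require Import structures.
From mathcomp Require Import all_boot all_order all_algebra all_fingroup.
From mathcomp Require Import generic_quotient ring_quotient boolp.

Set Implicit Arguments.
Unset Strict Implicit.
Unset Printing Implicit Defensive.

Import GRing.Theory.
Local Open Scope ring_scope.
Local Open Scope quotient_scope.

(** * Quotients of rational vector spaces *)

Section LinearQuotient.
Variables (V : lmodType rat) (G : V -> Prop).

Inductive in_span : V -> Prop :=
  | in_span0 : in_span 0
  | in_spanD (a : rat) (g v : V) : G g -> in_span v -> in_span (a *: g + v).

Lemma in_spanZ (a : rat) (v : V) : in_span v -> in_span (a *: v).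
Proof.
elim=> [|b g w Gg _ IHw]; first by rewrite scaler0; exact: in_span0.
by rewrite scalerDr scalerA; exact: in_spanD.
Qed.

Lemma in_span_add (u v : V) : in_span u -> in_span v -> in_span (u + v).
Proof.
move=> + Hv; elim=> [|b g w Gg _ IHw]; first by rewrite add0r.
by rewrite -addrA; exact: in_spanD.
Qed.

Definition span (v : V) : bool := `[< in_span v >].

Lemma span_zmod_closed : zmod_closed span.
Proof.
split=> [|u v /asboolP Hu /asboolP Hv]; apply/asboolP; first exact: in_span0.
by rewrite -scaleN1r; apply: in_span_add => //; exact: in_spanZ.
Qed.

HB.instance Definition _ := GRing.isZmodClosed.Build V span span_zmod_closed.

(* V / <G>. *)
Definition lquot := Quotient.quot (GRing.ZmodClosed.clone V span _).

HB.instance Definition _ := GRing.Zmodule.on lquot.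
HB.instance Definition _ := EqQuotient.on lquot.

Definition lproj (v : V) : lquot := \pi_lquot v.
Definition lrepr (x : lquot) : V := repr x.

Lemma lreprK : cancel lrepr lproj.
Proof. exact: reprK. Qed.

Lemma lproj_eqP (u v : V) : in_span (u - v) <-> lproj u = lproj v.
Proof.
split=> [Huv|/eqP]; last by rewrite -Quotient.idealrBE => /asboolP.
by apply/eqP; rewrite -Quotient.idealrBE; apply/asboolP.
Qed.

Lemma lprojD : {morph lproj : u v / u + v}.
Proof. by move=> u v; rewrite /lproj !piE. Qed.

Definition lquot_scale (a : rat) (x : lquot) : lquot := lproj (a *: lrepr x).

Lemma lproj_scale (a : rat) (v : V) : lquot_scale a (lproj v) = lproj (a *: v).
Proof.
apply/lproj_eqP; rewrite -scalerBr; apply: in_spanZ.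
by apply/lproj_eqP; rewrite lreprK.
Qed.

Lemma lquot_scaleA (a b : rat) (x : lquot) :
  lquot_scale a (lquot_scale b x) = lquot_scale (a * b) x.
Proof. by rewrite -[x]lreprK !lproj_scale scalerA. Qed.

Lemma lquot_scale1 : left_id 1 lquot_scale.
Proof. by move=> x; rewrite -[x]lreprK lproj_scale scale1r. Qed.

Lemma lquot_scaleDr : right_distributive lquot_scale +%R.
Proof.
move=> a x y; rewrite -[x]lreprK -[y]lreprK.
by rewrite -lprojD !lproj_scale -lprojD scalerDr.
Qed.

Lemma lquot_scaleDl (x : lquot) : {morph lquot_scale^~ x : a b / a + b}.
Proof. by move=> a b; rewrite -[x]lreprK !lproj_scale -lprojD scalerDl. Qed.

HB.instance Definition _ := GRing.Zmodule_isLmodule.Build rat lquot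
  lquot_scaleA lquot_scale1 lquot_scaleDr lquot_scaleDl.

Lemma lproj_is_semilinear : semilinear lproj.
Proof. by split=> [a v|]; [rewrite -lproj_scale | exact: lprojD]. Qed.

HB.instance Definition _ :=
  GRing.isSemilinear.Build rat V lquot *:%R lproj lproj_is_semilinear.

End LinearQuotient.

Arguments lproj {V} G v.

(** * Operads *)

(* The structure maps of a symmetric unital operad in rational vector spaces.
   [circ x i y] is the partial composition of [y] at the input [i] of [x];
   inputs are numbered from 0.  The definitions below only use the structure
   maps, so the operad axioms are not bundled with them. *)
Record operad_data := OperadData {
  component :> nat -> lmodType rat;
  sym_act : forall n, 'S_n -> component n -> component n;
  op_unit : component 1;
  circ : forall m n,
    component m.+1 -> 'I_m.+1 -> component n -> component (m + n)
}.

Section OperadGroup.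
Variable P : operad_data.

(* [circ] on operations of unspecified arity; the input [i] is meant to be
   smaller than the arity of [x]. *)
Definition circ_tagged (x : {n & P n}) (i : nat) (y : {n & P n}) : {n & P n} :=
  match x with
  | existT m.+1 x' =>
      Tagged (fun n => P n) (circ x' (inord i : 'I_m.+1) (tagged y))
  | existT 0 _ => Tagged (fun n => P n) (0 : P 0)
  end.

Fixpoint gamma_from (i : nat) (x : {n & P n}) (ys : seq {n & P n}) :
    {n & P n} :=
  if ys is y :: ys' then circ_tagged (gamma_from i.+1 x ys') i y else x.

(* gamma (x; y_0, ..., y_(m-1)) is the iterated partial composition
   (... ((x o_(m-1) y_(m-1)) o_(m-2) y_(m-2)) ...) o_0 y_0. *)
Definition gamma (x : {n & P n}) (ys : seq {n & P n}) : {n & P n} :=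
  gamma_from 0 x ys.

Definition coinv_rel n (z : P n) : Prop :=
  exists (s : 'S_n) (x : P n), z = sym_act s x - x.

Definition coinv n := lquot (@coinv_rel n).

(* The product of the coinvariants over the arities n >= 1: the value of an
   element at [n] is its component of arity [n.+1]. *)
Definition completion := forall n, coinv n.+1.

(* The class in arity [n] of an operation; 0 if the arity is not [n]. *)
Definition class_in n (x : {k & P k}) : coinv n :=
  untag 0 (lproj (@coinv_rel n)) x.

Definition comp_repr (x : completion) (n : nat) : {k & P k} :=
  Tagged (fun k => P k) (lrepr (x n)).

(* In arity N.+1, the arity of [x] is m.+1 and the arity of the i-th operation
   taken from [y] is (n i).+1; they are at most N.+1 since all the arities of
   the [y]'s are positive and add up to N.+1. *)
Definition times (x y : completion) : completion := fun N =>
  \sum_(m < N.+1)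
    \sum_(n : m.+1.-tuple 'I_N.+1
          | (\sum_(i < m.+1) (tnth n i).+1)%N == N.+1)
      class_in N.+1
        (gamma (comp_repr x m) [seq comp_repr y (nat_of_ord k) | k <- n]).

Definition unit_completion : completion := fun n =>
  class_in n.+1 (Tagged (fun k => P k) (op_unit P)).

Definition is_inverse (x y : completion) : Prop :=
  times x y = unit_completion /\ times y x = unit_completion.

(* Membership in the group of invertible elements of the completion. *)
Definition in_group (x : completion) : Prop := exists y, is_inverse x y.

End OperadGroup.

Section QuotientOperad.
Variables (P : operad_data) (I : forall n, P n -> Prop).

(* The quotient of an operad by the ideal spanned by [I]. *)
Definition quotient_operad : operad_data := {|
  component := fun n => lquot (@I n);
  sym_act := fun n s x => lproj (@I n) (sym_act s (lrepr x));
  op_unit := lproj (@I 1) (op_unit P);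
  circ := fun m n x i y => lproj (@I (m + n)) (circ (lrepr x) i (lrepr y))
|}.

Definition quotient_map n (x : P n) : quotient_operad n :=
  lproj (@I n) x.

End QuotientOperad.

(* The map between completions induced by a morphism of operads. *)
Definition completion_map (P Q : operad_data) (f : forall n, P n -> Q n)
    (x : completion P) : completion Q :=
  fun n => lproj (@coinv_rel Q n.+1) (f n.+1 (lrepr (x n))).

(** * Rooted trees *)

(* A rooted tree on the vertex set [V] is given by its parent function, with
   value [None] exactly at the root, which every vertex reaches. *)
Definition is_rtree (V : finType) (p : {ffun V -> option V}) : bool :=
  [exists r, (p r == None) && [forall v, connect (fun a b => p a == Some b) v r]].

Definition rtree (V : finType) := {p : {ffun V -> option V} | is_rtree p}.

(* Incoming edges are identified with their sources. *)
Definition incoming (V : finType) (T : rtree V) (i : V) :=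
  {j : V | val T j == Some i}.

Definition linear_tree (V : finType) (T : rtree V) : bool :=
  [forall i : V, #|{: incoming T i}| <= 1]%N.

Section TreeOperations.
Variables V W : finType.

Section Insertion.
Variables (T : rtree V) (i : V) (S : rtree W).

Definition insertion_vertex : finType := ({j : V | j != i} + W)%type.

Definition outer_vertex (v : V) : option insertion_vertex :=
  omap inl (insub v : option {j : V | j != i}).

(* The parent function of T o_i^f S. *)
Definition insertion (f : {ffun incoming T i -> W}) :
    {ffun insertion_vertex -> option insertion_vertex} :=
  [ffun a => match a with
   | inl j =>
       if insub (val j) is Some e then Some (inr (f e))
       else obind outer_vertex (val T (val j))
   | inr k =>
       if val S k is Some k' then Some (inr k')
       else obind outer_vertex (val T i)
   end].

End Insertion.

(* The root of [T] is grafted onto the vertex [s] of [S] by a new edge. *)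
Definition grafting (S : rtree V) (s : V) (T : rtree W) :
    {ffun V + W -> option (V + W)} :=
  [ffun a => match a with
   | inl v => omap inl (val S v)
   | inr w => if val T w is Some w' then Some (inr w') else Some (inl s)
   end].

End TreeOperations.

(** * The operad PreLie *)

(* Formal rational combinations of the rooted trees on n labeled vertices. *)
Notation PreLie_space n := {ffun rtree 'I_n -> rat^o} (only parsing).

(* The basis vector of the tree obtained from the tree [p] by transporting its
   vertices along the bijection [h]. *)
Definition tree_vec (V : finType) (p : {ffun V -> option V}) (n : nat)
    (h : V -> 'I_n) : PreLie_space n :=
  [ffun U : rtree 'I_n => [forall v, val U (h v) == omap h (p v)]%:R : rat^o].

Definition PreLie_act n (s : 'S_n) (x : PreLie_space n) : PreLie_space n :=
  \sum_(T : rtree 'I_n) x T *: tree_vec (val T) s.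

Fact insertion_label_subproof m n (i : 'I_m.+1)
    (a : {j : 'I_m.+1 | j != i} + 'I_n) :
  (match a with
   | inl j => if val j < i then nat_of_ord (val j) else (val j).-1 + n
   | inr k => i + k
   end < m + n)%N.
Proof.
case: a => [[j ji]|k] /=; last first.
  by rewrite -addnS leq_add // -ltnS.
case: (ltnP j i) => [lt_ji|le_ij].
  by rewrite (leq_trans lt_ji) // (leq_trans _ (leq_addr n m)) // -ltnS.
have lt_ij : (i < j)%N by rewrite ltn_neqAle le_ij andbT eq_sym.
by rewrite ltn_add2r -ltnS prednK ?(leq_ltn_trans _ lt_ij).
Qed.

(* The usual numbering of the inputs of a partial composition. *)
Definition insertion_label m n (i : 'I_m.+1)
    (a : {j : 'I_m.+1 | j != i} + 'I_n) : 'I_(m + n) :=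
  Ordinal (insertion_label_subproof a).

Definition PreLie_circ m n (x : PreLie_space m.+1) (i : 'I_m.+1)
    (y : PreLie_space n) : PreLie_space (m + n) :=
  \sum_(T : rtree 'I_m.+1) \sum_(S : rtree 'I_n)
    (x T * y S) *:
      \sum_(f : {ffun incoming T i -> 'I_n})
        tree_vec (insertion S f) (@insertion_label m n i).

(* The one-vertex tree. *)
Definition PreLie_unit : PreLie_space 1 :=
  tree_vec [ffun _ : 'I_1 => None] id.

Definition PreLie : operad_data := {|
  component := fun n => PreLie_space n;
  sym_act := PreLie_act;
  op_unit := PreLie_unit;
  circ := PreLie_circ
|}.

(** * The free pre-Lie algebra on one generator *)

(* Both orders of the summands give the same operation on unlabeled trees;
   labelling the vertices of [T] first makes the arity of v <- v, of
   (v <- v) <- v and so on reduce to a successor. *)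
Definition grafting_label m n (a : 'I_m + 'I_n) : 'I_(n + m) :=
  match a with inl s => rshift n s | inr t => lshift m t end.

Definition labeled_prelie_product m n (x : PreLie m) (y : PreLie n) :
    PreLie (n + m) :=
  \sum_(S : rtree 'I_m) \sum_(T : rtree 'I_n)
    ((x : PreLie_space m) S * (y : PreLie_space n) T) *:
      \sum_(s < m) tree_vec (grafting S s T) (@grafting_label m n).

Definition prelie_product m n (x : coinv PreLie m) (y : coinv PreLie n) :
    coinv PreLie (n + m) :=
  lproj (@coinv_rel PreLie (n + m))
    (labeled_prelie_product (lrepr x) (lrepr y)).

Definition prelie_generator : coinv PreLie 1 := lproj (@coinv_rel PreLie 1) PreLie_unit.

(* The left-normed power with k.+1 factors, (... (v <- v) ...) <- v. *)
Fixpoint prelie_power (k : nat) : coinv PreLie k.+1 :=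
  if k is k'.+1 then prelie_product (prelie_power k') prelie_generator
  else prelie_generator.

(* The power with k factors is homogeneous of degree k, so that it is the only
   one which contributes in arity k to the sum over k of v^(<- k) / k!. *)
Definition exp_star : completion PreLie :=
  fun n => (n.+1)`!%:R^-1 *: prelie_power n.

(** * The operad As *)

Definition nonlinear n (x : PreLie n) : Prop :=
  exists T : rtree 'I_n, ~~ linear_tree T /\ x = tree_vec (val T) id.

Definition As : operad_data := quotient_operad nonlinear.

Definition phi : completion PreLie -> completion As :=
  completion_map (quotient_map nonlinear).

(* The linear tree with root 0 in which the parent of k.+1 is k. *)
Definition ladder n : {ffun 'I_n.+1 -> option 'I_n.+1} :=
  [ffun j => if nat_of_ord j is k.+1 then Some (inord k) else None].

(* The class of the linear tree with n.+1 vertices. *)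
Definition theta n : coinv As n.+1 :=
  lproj (@coinv_rel As n.+1)
    (quotient_map nonlinear (tree_vec (ladder n) id : PreLie n.+1)).

(* A formal power series is given by its coefficients; those considered here
   have no constant term.  The series x^n is sent to the class of the linear
   tree with n vertices. *)
Definition completion_of_series (a : nat -> rat) : completion As :=
  fun n => a n.+1 *: theta n.

(* exp x - 1 *)
Definition exp_series (n : nat) : rat := n`!%:R^-1 - (n == 0%N)%:R.

(* log (1 + x) *)
Definition log_series (n : nat) : rat :=
  if n is k.+1 then (-1) ^+ k / n%:R else 0.

(* Main.v *)
From HB Require Import structures.
From mathcomp Require Import all_boot all_order all_algebra all_fingroup.
From mathcomp Require Import boolp zify.
Require Import Defs.

Set Implicit Arguments.
Unset Strict Implicit.
Unset Printing Implicit Defensive.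

Import GRing.Theory.
Local Open Scope ring_scope.

(** The product of the completion is a substitution, and everything follows
    from making the completion act, so that the product becomes composition.

    Suppose that an operad P operates on a vector space A, compatibly with
    partial compositions and relabelings ([operad_action]).  Then the iterated
    compositions which define the product of the completion evaluate, on a
    constant argument, to evaluations of evaluations ([evc_times]).  Two such
    actions of PreLie are used.

    The first one cuts trees.  Fix a parent map p on a finite set V, and let A
    be the space of functions on the subsets of V.  A labeled tree T with n
    vertices takes functions a_1, ..., a_n to the function whose value at C is
    the sum, over all ways of cutting C into n connected blocks such that
    contracting the blocks turns C into T, of the product of the a_j at the
    j-th block.  This is compatible with partial composition because cutting C
    along T o_i S amounts to cutting C along T and then cutting the i-th block
    along S ([cut_sum_insertion]).  As C has at most #|V| blocks, the completion
    acts on A, and the product acts as a composition ([act_times]).  When V is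
    the vertex set of a tree U, an element which acts on the indicator function
    of the singletons gives at C = V the coefficient of U, up to the order of
    the automorphism group; so the actions for all U together are faithful
    ([act_faithful]).  Hence the product is associative, with a left unit.  An
    element with leading term e has a left inverse, found degree by degree, with
    the same leading term; as in the proof that left inverses make a monoid a
    group, this left inverse is two-sided ([in_group_of_unit]).

    The second action is on the rational numbers.  Let lambda be the sum of the
    coefficients of the linear trees.  Both T o_i S and the grafting of T on S
    contain exactly one linear tree if T and S are linear, and none otherwise,
    so lambda is multiplicative.  Consequently lambda sends the left-normed
    powers of the generator to 1, and it sends the product of the completion to
    the composition of power series ([linear_coef_times]).  In As a nonlinear
    tree vanishes and the linear trees on n vertices become equal in the
    coinvariants, so the image of x in arity n is lambda(x) theta_n
    ([phi_linear_coef]).  This gives exp x - 1 for the image of exp-star.  If L is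
    the series of an inverse of exp-star, then exp L = 1 + x; differentiating,
    L' (1 + x) = 1, which determines the coefficients of L ([log_recurrence]). *)

(** * Rooted trees as parent maps with a rank *)

Lemma rtreeI (V : finType) (p : {ffun V -> option V}) (r : V) (d : V -> nat) :
  (forall v, p v = None <-> v = r) ->
  (forall v u, p v = Some u -> (d u < d v)%N) -> is_rtree p.
Proof.
move=> rP dP; apply/existsP; exists r; apply/andP; split; first by apply/eqP/rP.
apply/forallP=> v; have [n] := ubnP (d v).
elim: n v => // n IHn v lt_n; case pv: (p v) => [u|]; last first.
  by move/rP: pv => ->; exact: connect0.
apply: (connect_trans (connect1 _)); first exact/eqP/pv.
by apply: IHn; rewrite -ltnS (leq_trans _ lt_n) // ltnS dP.
Qed.

(** The rank is the depth: the number of steps from a vertex to the root.  With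
    it, induction along the parent map replaces reasoning on paths. *)
Lemma rtreeP (V : finType) (p : {ffun V -> option V}) :
  is_rtree p <->
  exists (r : V) (d : V -> nat),
    (forall v, p v = None <-> v = r) /\
    (forall v u, p v = Some u -> d v = (d u).+1).
Proof.
split=> [/existsP[r /andP[/eqP pr /forallP conn]]|[r [d [rP dP]]]].
  pose up k v := iter k (obind p) (Some v).
  have upN k : iter k (obind p) None = None by elim: k => //= k ->.
  have upS k v : up k.+1 v = obind (up k) (p v).
    by rewrite /up iterSr /=; case: (p v).
  have reach v : exists k, up k v = Some r.
    have /connectP[s] := conn v.
    elim: s v => [|w s IHs] v /=; first by move=> _ ->; exists 0%N.
    move=> /andP[/eqP pv Hs] Hr; have [k Hk] := IHs w Hs Hr.
    by exists k.+1; rewrite upS pv.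
  have ends v : exists k, up k v == None.
    by have [k Hk] := reach v; exists k.+1; rewrite /up iterS -/(up k v) Hk /= pr.
  exists r, (fun v => ex_minn (ends v)); split=> [v|v u pv].
    split=> [pv|->//]; have [[|k]] := reach v; first by case.
    by rewrite upS pv.
  case: ex_minnP => a /eqP Ha mina; case: ex_minnP => b /eqP Hb minb.
  case: a Ha mina => [//|a] Ha mina.
  have /minb ba : up a u == None by move: Ha; rewrite upS pv /= => ->.
  have /mina ab : up b.+1 v == None by rewrite upS pv /= Hb.
  by apply/eqP; rewrite eqn_leq ab ltnS ba.
by apply: (@rtreeI _ _ r d) => // v u /dP ->.
Qed.

(** [tree_vec] is defined by the same condition, so that a parent map on any
    vertex set stands for its copies on an ordinal. *)
Definition tree_iso (V W : finType) (h : V -> W) (p : {ffun V -> option V})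
    (q : {ffun W -> option W}) : Prop :=
  forall v, q (h v) = omap h (p v).

Lemma tree_iso_rtree (V W : finType) (h : V -> W) p q :
  bijective h -> tree_iso h p q -> is_rtree p -> is_rtree q.
Proof.
move=> [g hK gK] iso /rtreeP[r [d [rP dP]]]; apply/rtreeP.
exists (h r), (d \o g); split=> [w|w u].
  rewrite -[w]gK iso; split=> [|/(can_inj hK)/rP -> //].
  by case E: (p _) => [//|] _; move/rP: E => ->.
rewrite -[w]gK iso; case E: (p _) => [t|] //= [<-].
by rewrite /= !hK; exact: dP.
Qed.

Definition basis_tree n (T : rtree 'I_n) : {ffun rtree 'I_n -> rat^o} :=
  [ffun U => (U == T)%:R].

Lemma tree_vec_basis (V : finType) (p : {ffun V -> option V}) n
    (h : V -> 'I_n) :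
  bijective h -> is_rtree p ->
  exists2 U : rtree 'I_n, tree_iso h p (val U) &
    tree_vec p h = basis_tree U.
Proof.
move=> bij_h tree_p; have [g hK gK] := bij_h.
pose q := [ffun w => omap h (p (g w))].
have iso : tree_iso h p q by move=> v; rewrite ffunE hK.
exists (Sub q (tree_iso_rtree bij_h iso tree_p)); first by rewrite SubK.
apply/ffunP=> U; rewrite !ffunE -val_eqE SubK; congr (_%:R).
congr (nat_of_bool _); apply/forallP/eqP => [isoU|-> v]; last exact/eqP/iso.
by apply/ffunP=> w; rewrite -[w]gK (eqP (isoU _)) iso.
Qed.

Lemma tree_vec_iso (V : finType) (p : {ffun V -> option V}) n
    (h : V -> 'I_n) (T : rtree 'I_n) :
  bijective h -> is_rtree p -> tree_iso h p (val T) ->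
  tree_vec p h = basis_tree T.
Proof.
move=> bij_h tree_p iso; have [U isoU ->] := tree_vec_basis bij_h tree_p.
suff -> : T = U by [].
have [g hK gK] := bij_h.
by apply: val_inj; apply/ffunP=> v; rewrite -[v]gK iso isoU.
Qed.

Lemma tree_vec_id n (T : rtree 'I_n) : tree_vec (val T) id = basis_tree T.
Proof.
apply: tree_vec_iso; [by exists id | exact: (valP T)|].
by move=> v /=; case: (val T v).
Qed.

Lemma rtree_root (V : finType) (T : rtree V) :
  exists r, forall v, val T v = None <-> v = r.
Proof. by have /rtreeP[r [d [rP _]]] := valP T; exists r. Qed.

Lemma rtree_loopless (V : finType) (T : rtree V) v : val T v <> Some v.
Proof.
by have /rtreeP[r [d [_ dP]]] := valP T => /dP /eqP; rewrite ltn_eqF.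
Qed.

Lemma incoming_exists (V : finType) (T : rtree V) (i j : V) :
  val T j = Some i -> exists e : incoming T i, val e = j.
Proof. by move=> /eqP Tj; exists (exist _ j Tj). Qed.

Lemma outer_vertex_self (V W : finType) (i : V) : outer_vertex W i i = None.
Proof. by rewrite /outer_vertex insubF ?eqxx. Qed.

Lemma outer_vertex_neq (V W : finType) (i : V) (j : {j : V | j != i}) :
  outer_vertex W i (val j) = Some (inl j).
Proof. by rewrite /outer_vertex valK. Qed.

(** Case analysis for the vertices of T other than i inside T o_i S. *)
Variant outer_vertex_spec (V W : finType) (i v : V) :
    option (insertion_vertex W i) -> Prop :=
  | OuterSelf of v = i : outer_vertex_spec v None
  | OuterNeq (j : {j : V | j != i}) of v = val j :
      outer_vertex_spec v (Some (inl j)).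

Lemma outer_vertexP (V W : finType) (i v : V) :
  outer_vertex_spec v (outer_vertex W i v).
Proof.
have [->|neq] := eqVneq v i; first by rewrite outer_vertex_self; left.
by rewrite -[v]/(val (Sub v neq : {j : V | j != i})) outer_vertex_neq; right.
Qed.

Section Insertion.
Variables (V W : finType) (T : rtree V) (i : V) (S : rtree W).
Variable f : {ffun incoming T i -> W}.

Lemma insertion_incoming (e : incoming T i) (j : {j : V | j != i}) :
  val e = val j -> insertion S f (inl j) = Some (inr (f e)).
Proof. by move=> ej; rewrite ffunE /= -ej valK. Qed.

Lemma insertion_outer (j : {j : V | j != i}) :
  val T (val j) != Some i ->
  insertion S f (inl j) = obind (outer_vertex W i) (val T (val j)).
Proof. by move=> neq; rewrite ffunE /= insubF ?(negPf neq). Qed.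

Lemma insertion_inner (k : W) :
  insertion S f (inr k) =
    if val S k is Some k' then Some (inr k')
    else obind (outer_vertex W i) (val T i).
Proof. by rewrite ffunE. Qed.

Lemma incoming_neq (e : incoming T i) : val e != i.
Proof.
apply/eqP=> ei; have := eqP (valP e); rewrite ei; exact: rtree_loopless.
Qed.

Lemma insertion_edge (e : incoming T i) :
  insertion S f (inl (Sub (val e) (incoming_neq e))) = Some (inr (f e)).
Proof. exact: insertion_incoming. Qed.

Lemma insertion_rtree : is_rtree (insertion S f).
Proof.
have /rtreeP[r [d [rP dP]]] := valP T.
have /rtreeP[s [b [sP bP]]] := valP S.
(* Depths in T are scaled by M, which exceeds all depths in S, and depths in S
   are added inside the block which replaces i. *)
pose M := (\max_(k : W) b k).+1.
have bM k : (b k < M)%N by rewrite ltnS; exact: leq_bigmax.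
pose rank (a : insertion_vertex W i) := match a with
  | inl j => d (val j) * M | inr k => d i * M + b k end%N.
have outer_rank v a : outer_vertex W i v = Some a -> rank a = (d v * M)%N.
  by case: outer_vertexP => [//|j ->] [<-].
pose root := if outer_vertex W i r is Some a then a else inr s.
apply: (@rtreeI _ _ root rank) => [a|a u].
  case: a => [j|k].
    have [Tj|Tj] := eqVneq (val T (val j)) (Some i).
      have [e ej] := incoming_exists Tj.
      rewrite (insertion_incoming ej).
      split=> //; rewrite /root.
      case: outer_vertexP => [//|j' rj' [jj']].
      by have := (rP r).2 erefl; rewrite rj' -jj' Tj.
    rewrite insertion_outer //; rewrite /root; split.
      case E: (val T (val j)) => [u|] /=.
        by case: outer_vertexP => // ui; case/eqP: Tj; rewrite E ui.
      by move/rP: E => <- _; rewrite outer_vertex_neq.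
    by case: outer_vertexP => // j' rj' [->]; rewrite -rj' (rP r).2.
  rewrite insertion_inner /root; split.
    case E: (val S k) => [//|]; move/sP: E => ->.
    case E: (val T i) => [u|] /=.
      by case: outer_vertexP => // ui; case: (rtree_loopless (T := T) (v := i));
        rewrite E ui.
    by move/rP: E => <-; rewrite outer_vertex_self.
  case: outer_vertexP => // ri [->]; rewrite (sP s).2 //.
  by rewrite (_ : val T i = None) //; apply/rP.
case: a => [j|k].
  have [Tj|Tj] := eqVneq (val T (val j)) (Some i).
    have [e ej] := incoming_exists Tj.
    rewrite (insertion_incoming ej) => -[<-] /=.
    rewrite (dP _ _ Tj) mulSn addnC.
    by rewrite ltn_add2r bM.
  rewrite insertion_outer //; case E: (val T (val j)) => [v|] //= /outer_rank.
  by move=> ->; rewrite (dP _ _ E) ltn_mul2r ltnSn.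
rewrite insertion_inner; case E: (val S k) => [k'|].
  by move=> [<-] /=; rewrite ltn_add2l (bP _ _ E).
case F: (val T i) => [v|] //= /outer_rank ->.
by rewrite (dP _ _ F) mulSn (leq_trans _ (leq_addr _ _)) // addnC -addn1 leq_add2l.
Qed.

End Insertion.

Lemma grafting_rtree (V W : finType) (S : rtree V) (s : V) (T : rtree W) :
  is_rtree (grafting S s T).
Proof.
have /rtreeP[r [d [rP dP]]] := valP S.
have /rtreeP[t [b [tP bP]]] := valP T.
pose rank (a : V + W) := match a with
  | inl v => d v | inr w => d s + (b w).+1 end%N.
apply: (@rtreeI _ _ (inl r) rank) => [[v|w]|[v|w] u]; rewrite ffunE.
- by split=> [|[->]]; [case E: (val S v) => //; move/rP: E => -> |rewrite (rP r).2].
- by case: (val T w).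
- by case E: (val S v) => [v'|] //= [<-] /=; rewrite (dP _ _ E).
case E: (val T w) => [w'|] [<-] /=; first by rewrite (bP _ _ E) ltn_add2l.
by rewrite -addn1 leq_add2l.
Qed.

Lemma insertion_label_bij m n (i : 'I_m.+1) :
  bijective (@insertion_label m n i).
Proof.
apply: inj_card_bij; last first.
  rewrite card_sum !card_ord card_sig.
  by rewrite (eq_card (B := predC1 i)) // cardC1 card_ord.
have neqP (j : 'I_m.+1) : j != i -> (j : nat) <> i by move/eqP=> ji /val_inj.
move=> a b /(congr1 val) /=.
case: a b => [[a na]|a] [[b nb]|b] /= E.
- have ab : a = b; last by subst b; congr inl; apply: val_inj.
  by apply: val_inj => /=; move: E (neqP _ na) (neqP _ nb);
    case: (ltnP a i); case: (ltnP b i); lia.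
- by move: E (neqP _ na) (ltn_ord b); case: ltnP; lia.
- by move: E (neqP _ nb) (ltn_ord a); case: ltnP; lia.
by congr inr; apply: val_inj => /=; lia.
Qed.

Lemma grafting_label_bij m n : bijective (@grafting_label m n).
Proof.
apply: inj_card_bij; last by rewrite card_sum !card_ord addnC.
move=> [a|a] [b|b] /(congr1 val) /= E.
- by congr inl; apply: val_inj => /=; lia.
- by move: (ltn_ord b); lia.
- by move: (ltn_ord a); lia.
by congr inr; apply: val_inj.
Qed.

Lemma perm_bij n (s : 'S_n) : bijective s.
Proof. by exists (perm_inv s) => v; [exact: permK | exact: permKV]. Qed.

(** * Linear functionals on labeled trees *)

(** The values of an action on PreLie are given by linear functionals, and those
    are determined by their values on trees.  The lemmas below compute such a
    functional on the structure maps, which are sums of vectors [tree_vec]: it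
    suffices to know it on every tree isomorphic to the parent map at hand. *)
Section Pairing.
Variables (n : nat) (G : rtree 'I_n -> rat).

Definition pairing (x : {ffun rtree 'I_n -> rat^o}) : rat^o :=
  \sum_T x T * G T.

Lemma pairing_is_linear : linear pairing.
Proof.
move=> k x y; rewrite /pairing scaler_sumr -big_split; apply: eq_bigr => T _.
by rewrite !ffunE mulrDl -mulrA.
Qed.

HB.instance Definition _ :=
  GRing.isLinear.Build rat {ffun rtree 'I_n -> rat^o} rat^o _ pairing
    pairing_is_linear.

Lemma pairing_basis U : pairing (basis_tree U) = G U.
Proof.
rewrite /pairing (bigD1 U) //= ffunE eqxx mul1r big1 ?addr0 // => T /negPf TU.
by rewrite ffunE TU mul0r.
Qed.

Lemma pairing_tree_vec (V : finType) (p : {ffun V -> option V})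
    (h : V -> 'I_n) g :
  bijective h -> is_rtree p ->
  (forall U : rtree 'I_n, tree_iso h p (val U) -> G U = g) ->
  pairing (tree_vec p h) = g.
Proof.
move=> bij_h tree_p Gg; have [U isoU ->] := tree_vec_basis bij_h tree_p.
by rewrite pairing_basis Gg.
Qed.

End Pairing.

Lemma pairing_act n (G : rtree 'I_n -> rat) (G' : rtree 'I_n -> rat)
    (s : 'S_n) x :
  (forall T U : rtree 'I_n, tree_iso s (val T) (val U) -> G U = G' T) ->
  pairing G (PreLie_act s x) = pairing G' x.
Proof.
move=> GG'; rewrite /PreLie_act linear_sum; apply: eq_bigr => T _.
rewrite linearZ /=; congr (_ * _); apply: pairing_tree_vec.
- exact: perm_bij.
- exact: (valP T).
by move=> U; exact: GG'.
Qed.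

Lemma pairing_circ m n (G : rtree 'I_(m + n) -> rat)
    (g : forall (i : 'I_m.+1) (T : rtree 'I_m.+1) (S : rtree 'I_n),
           {ffun incoming T i -> 'I_n} -> rat) x i y :
  (forall T S (f : {ffun incoming T i -> 'I_n}) (U : rtree 'I_(m + n)),
     tree_iso (@insertion_label m n i) (insertion S f) (val U) ->
     G U = g i T S f) ->
  pairing G (PreLie_circ x i y) =
    \sum_T \sum_S (x T * y S) * \sum_f g i T S f.
Proof.
move=> Gg; rewrite /PreLie_circ linear_sum; apply: eq_bigr => T _.
rewrite linear_sum; apply: eq_bigr => S _; rewrite linearZ /=; congr (_ * _).
rewrite linear_sum; apply: eq_bigr => f _.
apply: pairing_tree_vec; first exact: insertion_label_bij.
  exact: insertion_rtree.
by move=> U; exact: Gg.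
Qed.

Lemma pairing_product m n (G : rtree 'I_(n + m) -> rat)
    (g : forall (S : rtree 'I_m) (T : rtree 'I_n), 'I_m -> rat) x y :
  (forall S T s (U : rtree 'I_(n + m)),
     tree_iso (@grafting_label m n) (grafting S s T) (val U) ->
     G U = g S T s) ->
  pairing G (labeled_prelie_product x y) =
    \sum_(S : rtree 'I_m) \sum_(T : rtree 'I_n)
      ((x : {ffun rtree 'I_m -> rat^o}) S * (y : {ffun rtree 'I_n -> rat^o}) T) *
      \sum_s g S T s.
Proof.
move=> Gg; rewrite /labeled_prelie_product linear_sum; apply: eq_bigr => S _.
rewrite linear_sum; apply: eq_bigr => T _; rewrite linearZ /=; congr (_ * _).
rewrite linear_sum; apply: eq_bigr => s _.
apply: pairing_tree_vec; first exact: grafting_label_bij.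
  exact: grafting_rtree.
by move=> U; exact: Gg.
Qed.

Lemma pairing_unit (G : rtree 'I_1 -> rat) g :
  (forall U : rtree 'I_1, val U ord0 = None -> G U = g) ->
  pairing G PreLie_unit = g.
Proof.
move=> Gg; apply: pairing_tree_vec; first by exists id.
  apply: (@rtreeI _ _ ord0 (fun=> 0%N)) => [v|v u]; rewrite ffunE //.
  by rewrite [v]ord1.
by move=> U iso; apply: Gg; rewrite (iso ord0) ffunE.
Qed.

(** * Evaluating an operad on a sequence of arguments *)

Lemma in_span_gen (V : lmodType rat) (G : V -> Prop) g : G g -> in_span G g.
Proof.
by move=> Gg; rewrite -[g]addr0 -[g]scale1r; apply: in_spanD (in_span0 _).
Qed.

Lemma lproj_sym (P : operad_data) n (s : 'S_n) (x : P n) :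
  lproj (@coinv_rel P n) (sym_act s x) = lproj (@coinv_rel P n) x.
Proof. by apply/lproj_eqP/in_span_gen; exists s, x. Qed.

(** The arguments of x when x o_i y is evaluated at a, where y has n inputs and b
    is the value of y. *)
Definition insert_arg (A : Type) (i n : nat) (b : A) (a : nat -> A) (j : nat) :=
  if (j < i)%N then a j else if j == i then b else a (j.-1 + n)%N.

(** Arguments form an infinite sequence, of which an operation of arity n reads
    the first n terms: this spares the casts between arities in iterated
    compositions.  Relabelings only ever meet constant arguments here, and units
    are left out because the unit of PreLie acts in the cutting action as a
    projector and not as the identity. *)
Record operad_action (P : operad_data) (A : lmodType rat) := OperadAction {
  eval :> forall n, P n -> (nat -> A) -> A;
  eval_linear : forall n (a : nat -> A), linear (fun x : P n => eval x a);
  eval_ext : forall n (x : P n) a b,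
    (forall i, (i < n)%N -> a i = b i) -> eval x a = eval x b;
  eval_sym : forall n (s : 'S_n) (x : P n) a,
    eval (sym_act s x) (fun=> a) = eval x (fun=> a);
  eval_circ : forall m n (x : P m.+1) (i : 'I_m.+1) (y : P n) a,
    eval (circ x i y) a =
      eval x (insert_arg i n (eval y (fun k => a (i + k)%N)) a)
}.

Section Action.
Variables (P : operad_data) (A : lmodType rat) (ev : operad_action P A).

Lemma eval0 n a : ev n 0 a = 0.
Proof.
by have := eval_linear ev a (-1) (0 : P n) 0; rewrite scaler0 add0r scaleN1r addNr.
Qed.

Lemma evalB n (x y : P n) a : ev _ (x - y) a = ev _ x a - ev _ y a.
Proof.
by have := eval_linear ev a (-1) y x; rewrite !scaleN1r [RHS]addrC => <-; rewrite addrC.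
Qed.

Definition evt (x : {n : nat & P n}) (a : nat -> A) : A := ev _ (tagged x) a.

Lemma evt_circ (x : {n : nat & P n}) i y a :
  (i < tag x)%N ->
  evt (circ_tagged x i y) a =
    evt x (insert_arg i (tag y) (evt y (fun k => a (i + k)%N)) a).
Proof.
case: x => -[//|m] x /= lt_i.
by rewrite /evt /= eval_circ inordK.
Qed.

Lemma tag_circ (x : {n : nat & P n}) i (y : {n : nat & P n}) :
  (i < tag x)%N -> (tag (circ_tagged x i y)).+1 = (tag x + tag y)%N.
Proof. by case: x => -[//|m]. Qed.

Lemma size_le_arities (ys : seq {n : nat & P n}) :
  all (fun y => 0 < tag y)%N ys -> (size ys <= sumn (map tag ys))%N.
Proof.
by elim: ys => //= y ys IHys /andP[y0 /IHys]; rewrite -add1n; exact: leq_add.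
Qed.

(** As the inserted operations have positive arity, no input that remains to be
    filled is lost, which keeps [circ_tagged] within its domain. *)
Lemma tag_gamma_from i (x : {n : nat & P n}) (ys : seq {n : nat & P n}) :
  all (fun y => 0 < tag y)%N ys -> (i + size ys <= tag x)%N ->
  (tag (gamma_from i x ys) + size ys = tag x + sumn (map tag ys))%N.
Proof.
elim: ys i => [|y ys IHys] i //= /andP[y_gt0 pos] le_i.
have := IHys i.+1 pos; rewrite addSn -addnS => /(_ le_i) E.
have := size_le_arities pos.
have lt_i : (i < tag (gamma_from i.+1 x ys))%N.
  by have := size_le_arities pos; lia.
by have := tag_circ y lt_i; lia.
Qed.

(** The compositions are performed from the last input to the first one.  So when
    input i is filled, the inputs before i still have their own arguments, which
    is why b is arbitrary there, while all further arguments are a. *)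
Lemma evt_gamma_from i (x : {n : nat & P n}) (ys : seq {n : nat & P n}) a b :
  all (fun y => 0 < tag y)%N ys -> (i + size ys <= tag x)%N ->
  (forall j, (i <= j)%N -> b j = a) ->
  evt (gamma_from i x ys) b =
    evt x (fun j => if (i <= j < i + size ys)%N
                    then evt (nth x ys (j - i)) (fun=> a) else b j).
Proof.
elim: ys i b => [|y ys IHys] i b /=.
  by move=> _ _ _; apply: eval_ext => j _; case: ifP => //; lia.
move=> /andP[y_gt0 pos] le_i ba.
have E := @tag_gamma_from i.+1 x ys pos; have le_size := size_le_arities pos.
rewrite evt_circ; last by lia.
rewrite IHys ?addSnnS //; last first.
  by move=> j lt_ij; rewrite /insert_arg ltnNge ltnW //= gtn_eqF // ba //; lia.
apply: eval_ext => j _; rewrite /insert_arg.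
have [lt_ji|lt_ij|->] := ltngtP j i.
- by [].
- rewrite /=; case: ifP => _; last by rewrite !ba //; lia.
  by rewrite -(subnSK lt_ij).
rewrite subnn /= ifT; last by lia.
by apply: eval_ext => k _; rewrite ba ?leq_addr.
Qed.

Lemma evt_gamma (x : {n : nat & P n}) (ys : seq {n : nat & P n}) a :
  all (fun y => 0 < tag y)%N ys -> size ys = tag x ->
  evt (gamma x ys) (fun=> a) = evt x (fun j => evt (nth x ys j) (fun=> a)).
Proof.
move=> pos size_ys; rewrite /gamma (@evt_gamma_from _ _ _ a) ?size_ys //.
by apply: eval_ext => j lt_j; rewrite leq0n add0n lt_j subn0.
Qed.

(** On constant arguments an evaluation descends to coinvariants. *)
Definition evc n (z : coinv P n) (a : A) : A := ev _ (lrepr z) (fun=> a).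

Lemma evc_lproj n (x : P n) a :
  evc (lproj (@coinv_rel P n) x) a = ev _ x (fun=> a).
Proof.
have kill z : in_span (@coinv_rel P n) z -> ev _ z (fun=> a) = 0.
  elim=> [|k g v [s [y ->]] _ IHv]; first exact: eval0.
  by rewrite eval_linear IHv addr0 evalB eval_sym subrr scaler0.
apply/eqP; rewrite -subr_eq0 -evalB; apply/eqP/kill/lproj_eqP.
by rewrite -/(lrepr _) lreprK.
Qed.

Lemma evc_linear n (a : A) : linear (fun z : coinv P n => evc z a).
Proof.
move=> k z w; rewrite -[z]lreprK -[w]lreprK -linearP /=.
by rewrite !evc_lproj eval_linear.
Qed.

Lemma evc0 n a : evc (0 : coinv P n) a = 0.
Proof.
by have := evc_linear a (-1) (0 : coinv P n) 0; rewrite scaler0 add0r scaleN1r addNr.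
Qed.

Lemma evcB n (z w : coinv P n) a : evc (z - w) a = evc z a - evc w a.
Proof.
by have := evc_linear a (-1) w z; rewrite !scaleN1r [RHS]addrC => <-; rewrite addrC.
Qed.

Lemma evc_sum n (I : Type) (r : seq I) (Q : pred I) (F : I -> coinv P n) a :
  evc (\sum_(i <- r | Q i) F i) a = \sum_(i <- r | Q i) evc (F i) a.
Proof.
apply: (big_morph (fun z => evc z a)) => [z w|]; last exact: evc0.
by have := evc_linear a 1 z w; rewrite !scale1r.
Qed.

Lemma evc_class_in n (x : {k : nat & P k}) a :
  evc (class_in n x) a = if tag x == n then evt x (fun=> a) else 0.
Proof.
rewrite /class_in /untag; case: eqP => [E|_]; last exact: evc0.
by rewrite evc_lproj; case: x E => k x /= E; subst k.
Qed.

Lemma tag_gamma_repr (x y : completion P) m (s : seq nat) :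
  size s = m.+1 ->
  tag (gamma (comp_repr x m) [seq comp_repr y k | k <- s]) =
    (\sum_(k <- s) k.+1)%N.
Proof.
move=> size_s; set ys := [seq _ | _ <- s].
have pos : all (fun z => 0 < tag z)%N ys by apply/allP => z /mapP[k _ ->].
have size_ys : size ys = m.+1 by rewrite size_map.
have := @tag_gamma_from 0 (comp_repr x m) ys pos; rewrite size_ys => /(_ (leqnn _)).
by rewrite addnC => /addnI ->; rewrite -map_comp sumnE big_map.
Qed.

Lemma evt_gamma_repr (x y : completion P) m (s : seq nat) a :
  size s = m.+1 ->
  evt (gamma (comp_repr x m) [seq comp_repr y k | k <- s]) (fun=> a) =
    ev _ (lrepr (x m)) (fun i => evc (y (nth 0 s i)) a).
Proof.
move=> size_s; rewrite evt_gamma ?size_map //; last first.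
  by apply/allP => z /mapP[k _ ->].
by apply: eval_ext => i lt_i; rewrite (nth_map 0%N) ?size_s.
Qed.

Lemma evc_times (x y : completion P) N a :
  evc (times x y N) a =
    \sum_(m < N.+1)
      \sum_(n : m.+1.-tuple 'I_N.+1
            | (\sum_(i < m.+1) (tnth n i).+1)%N == N.+1)
        ev _ (lrepr (x m))
          (fun i => evc (y (nth 0 [seq nat_of_ord k | k <- n] i)) a).
Proof.
rewrite /times evc_sum; apply: eq_bigr => m _.
rewrite evc_sum; apply: eq_bigr => n /eqP sum_n.
have size_n : size [seq nat_of_ord k | k <- n] = m.+1.
  by rewrite size_map size_tuple.
rewrite evc_class_in (map_comp (comp_repr y) (@nat_of_ord _)).
by rewrite tag_gamma_repr // evt_gamma_repr // big_map big_tuple sum_n eqxx.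
Qed.

End Action.

Arguments evc : simpl never.
Arguments evt : simpl never.

(** In [times] the type of the compositions of an integer depends on the arity of
    the result.  To sum over all arities, [sum_compositions] replaces it by a
    fixed type of functions; the two are compared through the sequences of their
    values. *)
Definition ffun_seq k K (f : {ffun 'I_k -> 'I_K}) : seq nat :=
  [seq nat_of_ord (f i) | i <- enum 'I_k].

Lemma size_ffun_seq k K (f : {ffun 'I_k -> 'I_K}) : size (ffun_seq f) = k.
Proof. by rewrite size_map size_enum_ord. Qed.

Lemma nth_ffun_seq k K (f : {ffun 'I_k -> 'I_K}) (i : 'I_k) :
  nth 0%N (ffun_seq f) i = f i.
Proof. by rewrite (nth_map i) ?size_enum_ord // nth_ord_enum. Qed.

Lemma sum_compositions (R : nmodType) k N K (F : seq nat -> R) :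
  (N < K)%N ->
  \sum_(n : k.-tuple 'I_N.+1 | (\sum_(i < k) (tnth n i).+1)%N == N.+1)
    F [seq nat_of_ord j | j <- n] =
  \sum_(f : {ffun 'I_k -> 'I_K} | (\sum_(i < k) (f i).+1)%N == N.+1)
    F (ffun_seq f).
Proof.
case: K => // K lt_NK.
pose h (f : {ffun 'I_k -> 'I_K.+1}) : k.-tuple 'I_N.+1 :=
  [tuple inord (f i) | i < k].
pose g (t : k.-tuple 'I_N.+1) : {ffun 'I_k -> 'I_K.+1} :=
  [ffun i => inord (tnth t i)].
rewrite (reindex_onto h g) => [|t _]; last first.
  apply: eq_from_tnth => i; rewrite tnth_mktuple ffunE inordK ?inord_val //.
  by rewrite (leq_trans (ltn_ord _)).
have valK (f : {ffun 'I_k -> 'I_K.+1}) i :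
    (f i <= N)%N -> nat_of_ord (tnth (h f) i) = f i.
  by move=> le_f; rewrite tnth_mktuple inordK.
have bound (f : {ffun 'I_k -> 'I_K.+1}) i :
    (\sum_(i < k) (f i).+1)%N == N.+1 -> (f i <= N)%N.
  by rewrite (bigD1 i) //= => /eqP; lia.
have bound' f i : g (h f) = f -> (f i <= N)%N.
  move=> /ffunP/(_ i); rewrite ffunE => <-.
  by rewrite -ltnS inordK // (leq_trans (ltn_ord _)).
have sumE (f : {ffun 'I_k -> 'I_K.+1}) : (forall i, (f i <= N)%N) ->
    (\sum_(i < k) (tnth (h f) i).+1 = \sum_(i < k) (f i).+1)%N.
  by move=> le_f; apply: eq_bigr => i _; rewrite valK.
apply: eq_big => [f|f /andP[_ /eqP ghf]].
  apply/andP/idP => [[sum_f /eqP ghf]|sum_f].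
    by rewrite -sumE // => i; exact: bound'.
  rewrite sumE; last by move=> i; exact: bound.
  split=> //.
  apply/eqP/ffunP => i; rewrite ffunE; apply: val_inj => /=.
  by rewrite valK ?bound // inordK // ltn_ord.
congr F; rewrite -[in LHS](map_tnth_enum (h f)) -map_comp.
by apply: eq_map => i /=; rewrite valK // bound'.
Qed.

(** * Contracting a parent map onto a tree *)

Lemma big_neq_sub (J : finType) (i : J) (F : J -> rat) :
  \prod_(j | j != i) F j = \prod_(j : {j : J | j != i}) F (val j).
Proof.
rewrite (reindex_omap (val : {j : J | j != i} -> J) insub); last first.
  by move=> j ji; rewrite insubT.
by apply: eq_bigl => -[j ji] /=; rewrite insubT ji eqxx.
Qed.

Section Contraction.
Variables (V : finType) (p : {ffun V -> option V}).

Definition block (J : finType) (c : {ffun V -> option J}) (j : J) : {set V} :=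
  [set v | c v == Some j].

Definition support (J : finType) (c : {ffun V -> option J}) : {set V} :=
  [set v | c v].

(** A partial colouring c of V is a cutting of its support into blocks.  In a tree,
    a block is connected exactly if it has one vertex whose parent is outside the
    block; asking for one such vertex per colour j, and that its parent have
    colour q j (or no colour, if j is a root of q), says that the blocks are
    connected and that contracting them gives q. *)
Definition contracts (J : finType) (c : {ffun V -> option J})
    (q : {ffun J -> option J}) : Prop :=
  forall j, exists v,
    [/\ c v = Some j, obind c (p v) = q j, q j <> Some j &
        forall w, c w = Some j -> obind c (p w) <> Some j -> w = v].

Definition cut_sum (J : finType) (a : J -> {set V} -> rat) (C : {set V})
    (q : {ffun J -> option J}) : rat :=
  \sum_(c : {ffun V -> option J} | (support c == C) && `[< contracts c q >])
    \prod_j a j (block c j).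

Lemma contracts_inj (J : finType) (c : {ffun V -> option J}) q q' :
  contracts c q -> contracts c q' -> q = q'.
Proof.
move=> cq cq'; apply/ffunP=> j.
have [v [cv pv qv _]] := cq j; have [v' [cv' pv' qv' uniq]] := cq' j.
by rewrite -pv -pv' (uniq v) // pv.
Qed.

(** Colours may be renamed along an isomorphism of the contracted trees. *)
Lemma cut_sum_iso (J J' : finType) (h : J -> J') a C q q' :
  bijective h -> tree_iso h q q' -> cut_sum a C q' = cut_sum (a \o h) C q.
Proof.
move=> [g hK gK] iso; rewrite /cut_sum.
pose rel (K K' : finType) (k : K -> K') (c : {ffun V -> option K}) :=
  [ffun v => omap k (c v)].
have relK : cancel (rel _ _ h) (rel _ _ g).
  by move=> c; apply/ffunP=> v; rewrite !ffunE; case: (c v) => //= j; rewrite hK.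
have relK' : cancel (rel _ _ g) (rel _ _ h).
  by move=> c; apply/ffunP=> v; rewrite !ffunE; case: (c v) => //= j; rewrite gK.
rewrite (reindex (rel _ _ h)) /=; last by exists (rel _ _ g) => c _.
apply: eq_big => [c|c _].
  congr (_ && _).
    congr (_ == _); apply/setP=> v; rewrite !inE ffunE; by case: (c v).
  have E j v : (omap h (c v) = Some (h j)) <-> (c v = Some j).
    by split=> [|->//]; case: (c v) => //= k [/(can_inj hK) ->].
  have E' v : obind (rel _ _ h c) (p v) = omap h (obind c (p v)).
    by case: (p v) => //= u; rewrite ffunE.
  have omap_inj := inj_omap (can_inj hK).
  apply/asboolP/asboolP => cq j.
    have [v [cv pv qv uniq]] := cq (h j); exists v; move: pv qv; rewrite E' iso.
    move=> /omap_inj pv qv; split=> //.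
    - by apply/E; move: cv; rewrite ffunE.
    - by move=> qj; apply: qv; rewrite qj.
    move=> w cw pw; apply: uniq; first by rewrite ffunE cw.
    by rewrite E' => /(omap_inj _ (Some j)).
  have [v [cv pv qv uniq]] := cq (g j); exists v; rewrite -[j]gK iso.
  rewrite ffunE cv E' pv gK; split=> //; first by congr Some; rewrite ?gK.
    by rewrite -{2}[j]gK => /(omap_inj _ (Some _)).
  move=> w; rewrite ffunE E' -{1 2}[j]gK => /E cw pw; apply: uniq => // ppw.
  by apply: pw; rewrite ppw.
rewrite (reindex h) /=; last by exists g => ? _.
apply: eq_bigr => j _; congr (a _ _); apply/setP=> v; rewrite !inE ffunE.
by case: (c v) => //= k; rewrite !(inj_eq Some_inj) (can_eq hK).
Qed.

(** A cutting c along T o_i S is the same as a cutting along T ([outer_part]: all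
    colours of S become i) and a cutting along S of its i-th block
    ([inner_part]). *)
Section Insertion.
Variables (J K : finType) (T : rtree J) (i : J) (S : rtree K).
Implicit Type (c : {ffun V -> option (insertion_vertex K i)}).

Definition outer_part c : {ffun V -> option J} :=
  [ffun v => omap (fun a => match a with inl j => val j | inr _ => i end) (c v)].

Definition inner_part c : {ffun V -> option K} :=
  [ffun v => obind (fun a => match a with inl _ => None | inr k => Some k end)
               (c v)].

Definition join_parts (c12 : {ffun V -> option J} * {ffun V -> option K}) :
    {ffun V -> option (insertion_vertex K i)} :=
  [ffun v => if c12.1 v == Some i then omap inr (c12.2 v)
             else obind (outer_vertex K i) (c12.1 v)].

Lemma join_partsK c : join_parts (outer_part c, inner_part c) = c.
Proof.
apply/ffunP=> v; rewrite !ffunE /=.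
case: (c v) => [[j|k]|] //=; last by rewrite eqxx.
by rewrite outer_vertex_neq (inj_eq Some_inj) (negPf (valP j)).
Qed.

Lemma support_inner c : support (inner_part c) = block (outer_part c) i.
Proof.
apply/setP=> v; rewrite !inE !ffunE; case: (c v) => [[j|k]|] //=.
  by rewrite (inj_eq Some_inj) (negPf (valP j)).
by rewrite eqxx.
Qed.

Lemma outer_join (c1 : {ffun V -> option J}) (c2 : {ffun V -> option K}) :
  support c2 = block c1 i -> outer_part (join_parts (c1, c2)) = c1.
Proof.
move=> /setP supp; apply/ffunP=> v; rewrite !ffunE /=.
have := supp v; rewrite !inE; case: eqP => [->|]; first by case: (c2 v).
case: (c1 v) => [u|] //= ne _.
by case: outer_vertexP => [ui|j ->] //; case: ne; rewrite ui.
Qed.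

Lemma inner_join (c1 : {ffun V -> option J}) (c2 : {ffun V -> option K}) :
  support c2 = block c1 i -> inner_part (join_parts (c1, c2)) = c2.
Proof.
move=> /setP supp; apply/ffunP=> v; rewrite !ffunE /=.
have := supp v; rewrite !inE; case: eqP => [_|]; first by case: (c2 v).
by move=> _; case: (c2 v) => // _; case: (c1 v) => //= u; case: outer_vertexP.
Qed.

Lemma support_outer c : support (outer_part c) = support c.
Proof. by apply/setP=> v; rewrite !inE ffunE; case: (c v). Qed.

Lemma block_outer c (j : {j : J | j != i}) :
  block (outer_part c) (val j) = block c (inl j).
Proof.
apply/setP=> v; rewrite !inE ffunE; case: (c v) => [[j'|k]|] //=.
by rewrite (inj_eq Some_inj) eq_sym (negPf (valP j)).
Qed.

Lemma block_inner c k : block (inner_part c) k = block c (inr k).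
Proof. by apply/setP=> v; rewrite !inE ffunE; case: (c v) => [[j'|k']|]. Qed.

Lemma obind_outer c (o : option V) :
  obind (outer_part c) o =
    omap (fun a => match a with inl j => val j | inr _ => i end) (obind c o).
Proof. by case: o => //= v; rewrite ffunE. Qed.

Lemma obind_inner c (o : option V) :
  obind (inner_part c) o =
    obind (fun a => match a with inl _ => None | inr k => Some k end)
      (obind c o).
Proof. by case: o => //= v; rewrite ffunE. Qed.

Lemma omap_outer_vertex (o : option J) : o <> Some i ->
  omap (fun a : insertion_vertex K i => match a with inl j => val j | inr _ => i end)
    (obind (outer_vertex K i) o) = o.
Proof.
by case: o => //= j ne; case: outer_vertexP => [ji|j' ->] //; case: ne; rewrite ji.
Qed.

(** The block of colour i is connected since S has a single root: a vertex of that
    block whose parent is outside has a colour without parent in S. *)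
Lemma contracts_parts c (f : {ffun incoming T i -> K}) : contracts c (insertion S f) ->
  contracts (outer_part c) (val T) /\ contracts (inner_part c) (val S).
Proof.
move=> cf; have [s sP] := rtree_root S.
have loop := @rtree_loopless _ T.
split=> j.
  have [ji|ne] := eqVneq j i.
    have [v [cv pv _ uniq]] := cf (inr s).
    move: pv; rewrite insertion_inner (sP s).2 // => pv.
    have pv' : obind (outer_part c) (p v) = val T i.
      by rewrite obind_outer pv omap_outer_vertex //; exact: loop.
    exists v; rewrite ji ffunE cv pv'; split=> //.
    move=> w; rewrite ffunE obind_outer.
    case cw: (c w) => [[j'|k]|] //=.
      by case=> /eqP; rewrite (negPf (valP j')).
    move=> _ pw; have [u [cu pu neu uniqk]] := cf (inr k).
    have wu : w = u by apply: uniqk => // cpw; rewrite cpw in pw.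
    move: pu; rewrite -wu insertion_inner; case Sk: (val S k) => [k'|].
      by move=> pw'; rewrite pw' in pw.
    by move/sP: Sk => ks _; apply: uniq; rewrite -ks // => cpw; rewrite cpw in pw.
  have [v [cv pv neq uniq]] := cf (inl (Sub j ne)).
  exists v; rewrite ffunE cv; split=> //.
  - rewrite obind_outer pv.
    have [Tj|Tj] := eqVneq (val T j) (Some i); last first.
      by rewrite insertion_outer // omap_outer_vertex //; exact/eqP.
    have [e ej] := incoming_exists Tj.
    by rewrite (insertion_incoming _ _ (e := e)) ?Tj.
  move=> w; rewrite ffunE obind_outer => cw pw; apply: uniq.
    case: (c w) cw => [[j'|k]|] //= [jj']; first by congr (Some (inl _)); apply: val_inj.
    by case/negP: (ne); rewrite jj'.
  by move=> cpw; rewrite cpw in pw.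
have [v [cv pv neq uniq]] := cf (inr j); exists v; rewrite ffunE cv.
split=> //.
- rewrite obind_inner pv insertion_inner; case: (val S j) => [k|] //.
  by case: (val T i) => //= u; case: outer_vertexP.
- exact: rtree_loopless.
move=> w; rewrite ffunE obind_inner => cw pw; apply: uniq.
  by case: (c w) cw => [[j'|k]|] //= [->].
by move=> cpw; rewrite cpw in pw.
Qed.

(** The map f is forced: it sends an edge e of T into i to the colour, in S, of the
    parent of the top vertex of the block of e. *)
Lemma contracts_join c :
  contracts (outer_part c) (val T) -> contracts (inner_part c) (val S) ->
  exists f : {ffun incoming T i -> K}, contracts c (insertion S f).
Proof.
move=> cT cS.
have top (e : incoming T i) : {k : K | exists v,
    [/\ c v = Some (inl (Sub (val e) (incoming_neq e))),
        obind c (p v) = Some (inr k) & forall w,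
          c w = c v -> obind c (p w) <> c v -> w = v]}.
  apply: cid; have [v [cv pv ne uniq]] := cT (val e).
  move: cv pv; rewrite ffunE obind_outer (eqP (valP e)).
  case cv: (c v) => [[j|k]|] //= [E]; last first.
    by case/eqP: (incoming_neq e).
  case cpv: (obind c (p v)) => [[j'|k]|] //= E'.
    by case: E' => E'; case/eqP: (valP j').
  exists k, v; rewrite cv cpv; split=> //.
    by congr (Some (inl _)); apply: val_inj.
  move=> w cw pw; apply: uniq; first by rewrite ffunE cw /= E.
  rewrite obind_outer => pw'; apply: pw; move: pw'.
  case: (obind c (p w)) => [[j'|k']|] //= [E''].
    by congr (Some (inl _)); apply: val_inj; rewrite /= E''.
  by case/eqP: (incoming_neq e).
exists [ffun e => sval (top e)] => -[j|k].
  have [Tj|Tj] := eqVneq (val T (val j)) (Some i).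
    have [e ej] := incoming_exists Tj.
    rewrite (insertion_incoming _ _ ej) ffunE.
    case: (top e) => k /= [v [cv pv uniq]].
    have cvj : c v = Some (inl j) by rewrite cv; congr (Some (inl _)); apply: val_inj.
    by exists v; rewrite pv; split=> // w; rewrite -cvj; exact: uniq.
  have [v [cv pv ne uniq]] := cT (val j); exists v.
  rewrite insertion_outer //.
  have cvj : c v = Some (inl j).
    move: cv; rewrite ffunE; case: (c v) => [[j'|k]|] //= [E].
      by congr (Some (inl _)); apply: val_inj.
    by case/eqP: (valP j).
  split=> //.
  - rewrite -pv obind_outer; move: pv; rewrite obind_outer.
    case: (obind c (p v)) => [[j'|k]|] //= E; first by rewrite outer_vertex_neq.
    by rewrite -E eqxx in Tj.
  - case E: (val T (val j)) => [u|] //=.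
    case: outer_vertexP => [//|j' uj'] [jj'].
    by case: (@rtree_loopless _ T (val j)); rewrite E uj' jj'.
  move=> w cw pw; apply: uniq; first by rewrite ffunE cw.
  rewrite obind_outer => pw'; apply: pw; move: pw'.
  case: (obind c (p w)) => [[j'|k']|] //= [E''].
    by congr (Some (inl _)); apply: val_inj; rewrite /= E''.
  by case/eqP: (valP j).
have [v [cv pv ne uniq]] := cS k; exists v.
have cvk : c v = Some (inr k).
  by move: cv; rewrite ffunE; case: (c v) => [[j'|k']|] //= [->].
rewrite insertion_inner; split=> //.
- move: pv; rewrite obind_inner; case Sk: (val S k) => [k'|].
    by case: (obind c (p v)) => [[j'|k'']|] //= [->].
  move=> pv; have [t [ct pt net uniqt]] := cT i.
  have vt : v = t.
    apply: uniqt; first by rewrite ffunE cvk.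
    rewrite obind_outer; case: (obind c (p v)) pv => [[j'|k']|] //= _ [E].
    by case/eqP: (valP j').
  move: pt; rewrite -vt obind_outer; case: (obind c (p v)) pv => [[j'|k']|] //= _ <- //.
  by rewrite /= outer_vertex_neq.
- case: (val S k) ne => [k' ne [kk']|_]; first by apply: ne; rewrite kk'.
  by case: (val T i) => //= u; case: outer_vertexP.
move=> w cw pw; apply: uniq; first by rewrite ffunE cw.
rewrite obind_inner => pw'; apply: pw; move: pw'.
by case: (obind c (p w)) => [[j'|k']|] //= [->].
Qed.

Lemma insertion_inj : injective (@insertion _ _ T i S).
Proof.
move=> f f' /ffunP E; apply/ffunP=> e.
have := E (inl (Sub (val e) (incoming_neq e))).
by rewrite !(insertion_incoming _ _ (e := e)) // => -[].
Qed.

(** Partial composition corresponds to refining the block of colour i: each pair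
    of an outer and an inner cutting comes from one joint cutting, which
    contracts onto T o_i^f S for exactly one f. *)
Lemma cut_sum_insertion (a : insertion_vertex K i -> {set V} -> rat) C :
  \sum_f cut_sum a C (@insertion _ _ T i S f) =
  \sum_(c1 : {ffun V -> option J} | (support c1 == C) && `[< contracts c1 (val T) >])
    (\prod_(j : {j : J | j != i}) a (inl j) (block c1 (val j))) *
    cut_sum (fun k => a (inr k)) (block c1 i) (val S).
Proof.
pose W c := \prod_j a j (block c j).
(* For each c at most one f contributes, and one does if both parts contract. *)
have -> : \sum_f cut_sum a C (@insertion _ _ T i S f) =
    \sum_(c | (support c == C) && (`[< contracts (outer_part c) (val T) >]
                 && `[< contracts (inner_part c) (val S) >])) W c.
  rewrite /cut_sum (exchange_big_dep (fun c => support c == C)) /=; last first.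
    by move=> f c _ /andP[].
  rewrite [RHS]big_mkcondr; apply: eq_bigr => c suppc; case: ifP => [|no].
    move=> /andP[/asboolP cT /asboolP cS]; have [f cf] := contracts_join cT cS.
    rewrite (big_pred1 f) // => f'; rewrite suppc /=.
    apply/asboolP/eqP => [cf'|->//].
    by apply: insertion_inj; exact: contracts_inj cf' cf.
  rewrite big1 // => f /andP[_ /asboolP /contracts_parts[/asboolP cT /asboolP cS]].
  by rewrite cT cS in no.
under [RHS]eq_bigr do rewrite big_distrr /=.
rewrite pair_big_dep /=.
rewrite (reindex_onto (fun c => (outer_part c, inner_part c)) join_parts) /=.
  apply: eq_big => [c|c _].
    rewrite support_outer support_inner join_partsK !eqxx andbT /=.
    by rewrite -andbA.
  rewrite /W big_sumType /=; congr (_ * _); apply: eq_bigr => j _.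
    by rewrite block_outer.
  by rewrite block_inner.
move=> [c1 c2] /andP[_ /andP[/eqP supp _]] /=.
by rewrite outer_join ?inner_join.
Qed.

End Insertion.
End Contraction.

(** * The evaluation by cuttings *)

Section CutAction.
Variables (V : finType) (p : {ffun V -> option V}).

Definition cut_space : lmodType rat := {ffun {set V} -> rat^o}.

Definition cut_eval n (x : PreLie n) (a : nat -> cut_space) : cut_space :=
  [ffun C => pairing (fun T => cut_sum p (fun j : 'I_n => a j) C (val T)) x].

Lemma cut_eval_linear n a : linear (fun x : PreLie n => cut_eval x a).
Proof. by move=> k x y; apply/ffunP=> C; rewrite !ffunE linearP. Qed.

Lemma cut_eval_ext n (x : PreLie n) a b :
  (forall i, (i < n)%N -> a i = b i) -> cut_eval x a = cut_eval x b.
Proof.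
move=> ab; apply/ffunP=> C; rewrite !ffunE; apply: eq_bigr => T _.
congr (_ * _); apply: eq_bigr => c _; apply: eq_bigr => j _.
by rewrite ab.
Qed.

Lemma cut_eval_sym n (s : 'S_n) (x : PreLie n) a :
  cut_eval (sym_act s x) (fun=> a) = cut_eval x (fun=> a).
Proof.
apply/ffunP=> C; rewrite !ffunE; apply: pairing_act => T U iso.
by apply: cut_sum_iso iso; exact: perm_bij.
Qed.

Lemma cut_eval_circ m n (x : PreLie m.+1) (i : 'I_m.+1) (y : PreLie n) a :
  cut_eval (circ x i y) a =
    cut_eval x (insert_arg i n (cut_eval y (fun k => a (i + k)%N)) a).
Proof.
apply/ffunP=> C; rewrite !ffunE.
rewrite (pairing_circ (g := fun i T S f =>
   cut_sum p ((fun j : 'I_(m + n) => a j : {ffun _ -> rat}) \o @insertion_label m n i) C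
     (insertion S f))); last first.
  move=> T S f U iso; apply: cut_sum_iso iso; exact: insertion_label_bij.
apply: eq_bigr => T _.
under eq_bigr => S _ do rewrite cut_sum_insertion -mulrA.
rewrite -big_distrr /=; congr (_ * _).
under eq_bigr => S _ do rewrite big_distrr /=.
rewrite exchange_big /=; apply: eq_bigr => c1 _.
rewrite [RHS](bigD1 i) //= /insert_arg ltnn eqxx ffunE mulrC.
rewrite big_neq_sub /pairing big_distrr /=; apply: eq_bigr => S _.
rewrite mulrCA; congr (_ * (_ * _)); last first.
apply: eq_bigr => j _ /=.
have ne : (val j : nat) <> i by move=> /val_inj ji; case/eqP: (valP j).
by case: (ltngtP (val j) i) => // _; case: ifP.
Qed.

Definition cut_action : operad_action PreLie cut_space :=
  OperadAction cut_eval_linear cut_eval_ext cut_eval_sym cut_eval_circ.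

End CutAction.

(** * The action of the completion *)

Lemma leq_sum_succ k (F : 'I_k -> nat) : (k <= \sum_(i < k) (F i).+1)%N.
Proof. by rewrite -{1}(card_ord k) -sum1_card; apply: leq_sum. Qed.

Section Act.
Variables (V : finType) (p : {ffun V -> option V}).
Local Notation ev := (cut_action p).

(** The sum is finite, with #|V| terms, since each block of a cutting is nonempty
    ([cut_eval_vanish]). *)
Definition act (x : completion PreLie) (a : cut_space V) : cut_space V :=
  \sum_(n < #|V|) evc ev (x n) a.

Lemma cut_eval_vanish n (x : PreLie n) a : (#|V| < n)%N -> ev _ x a = 0.
Proof.
move=> lt_Vn; apply/ffunP=> C; rewrite !ffunE; apply: big1 => T _.
rewrite /cut_sum big1 ?mulr0 // => c /andP[_ /asboolP cT].
have top j : {v | c v = Some j} by apply: cid; have [v []] := cT j; exists v.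
have /leq_card : injective (fun j => sval (top j)).
  by move=> j k E; have := svalP (top j); rewrite E (svalP (top k)) => -[].
by rewrite card_ord leqNgt lt_Vn.
Qed.

(** Multilinearity: the same finite sum is substituted in each argument. *)
Lemma cut_eval_distr n (x : PreLie n) K (b : nat -> cut_space V) :
  ev _ x (fun=> \sum_(k < K) b k) =
  \sum_(f : {ffun 'I_n -> 'I_K}) ev _ x (fun i => b (nth 0%N (ffun_seq f) i)).
Proof.
apply/ffunP=> C; rewrite sum_ffunE ffunE /pairing.
under [RHS]eq_bigr => f _ do rewrite ffunE.
rewrite exchange_big; apply: eq_bigr => T _ /=; rewrite -big_distrr /=.
congr (_ * _); rewrite exchange_big; apply: eq_bigr => c _ /=.
under eq_bigr => j _ do rewrite sum_ffunE.
rewrite bigA_distr_bigA; apply: eq_bigr => f _; apply: eq_bigr => j _.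
by rewrite nth_ffun_seq.
Qed.

(** The compositions n_1 + ... + n_m of all the integers, which appear in the
    components of the product, together run through all choices of one term of
    [act y a] in each of the m arguments.  Those of an integer above #|V| are
    missing on the left-hand side, but contribute zero. *)
Lemma act_times x y a : act (times x y) a = act x (act y a).
Proof.
pose H m (s : seq nat) := ev _ (lrepr (x m)) (fun i => evc ev (y (nth 0%N s i)) a).
have H0 m (s : seq nat) : size s = m.+1 ->
    (#|V| < \sum_(k <- s) k.+1)%N -> H m s = 0.
  move=> size_s lt_V; rewrite /H -evt_gamma_repr //; apply: cut_eval_vanish.
  by rewrite tag_gamma_repr.
(* The arity of the operation composed from the choice f. *)
pose w m (f : {ffun 'I_m.+1 -> 'I_#|V|}) := (\sum_(i < m.+1) (f i).+1)%N.
transitivity (\sum_(N < #|V|) \sum_(m < #|V|)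
   \sum_(f : {ffun 'I_m.+1 -> 'I_#|V|} | w m f == N.+1) H m (ffun_seq f)).
  apply: eq_bigr => N _; rewrite evc_times.
  under eq_bigr => m _ do
    rewrite (sum_compositions _ (H m) (ltn_ord N)).
  rewrite [RHS](bigID (fun m : 'I__ => m < N.+1)%N) /= [X in _ = _ + X]big1.
    by rewrite addr0 -(big_ord_widen _ (fun m =>
      \sum_(f : {ffun 'I_m.+1 -> 'I_#|V|} | w m f == N.+1) H m (ffun_seq f))).
  move=> m; rewrite -leqNgt => lt_Nm; rewrite big_pred0 // => f.
  apply/negbTE; rewrite gtn_eqF // /w (leq_ltn_trans lt_Nm) //; exact: leq_sum_succ.
rewrite exchange_big; apply: eq_bigr => m _ /=.
transitivity (\sum_(f : {ffun 'I_m.+1 -> 'I_#|V|}) H m (ffun_seq f)); last first.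
  by rewrite -(cut_eval_distr _ _ (fun k => evc ev (y k) a)).
under eq_bigr => N _ do rewrite big_mkcond.
rewrite exchange_big /=; apply: eq_bigr => f _.
rewrite -big_mkcond /=.
have wE : w m f = (\sum_(k <- ffun_seq f) k.+1)%N.
  by rewrite big_map big_enum.
have [lt_V|le_V] := ltnP #|V| (w m f).
  by rewrite H0 ?size_ffun_seq -?wE // big1.
have w_gt0 : (0 < w m f)%N by rewrite /w big_ord_recl.
have lt_w : ((w m f).-1 < #|V|)%N by rewrite prednK.
rewrite (big_pred1 (Ordinal lt_w)) // => N /=.
by rewrite -val_eqE /= -[in LHS](prednK w_gt0) eqSS eq_sym.
Qed.

(** The unit of PreLie, as the one-vertex tree, cuts C into a single block; so it
    preserves the values at the connected sets C and kills the other ones.  That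
    C is connected is expressed as contractibility onto one vertex. *)
Definition collapse (C : {set V}) : {ffun V -> option 'I_1} :=
  [ffun v => if v \in C then Some ord0 else None].

Definition one_vertex : {ffun 'I_1 -> option 'I_1} := [ffun=> None].

Definition connected_support (a : cut_space V) : Prop :=
  forall C, a C != 0 -> contracts p (collapse C) one_vertex.

Lemma evc_unit (a : cut_space V) :
  connected_support a -> evc ev (unit_completion PreLie 0) a = a.
Proof.
move=> conn; rewrite /unit_completion evc_class_in eqxx.
apply/ffunP=> C; rewrite ffunE.
rewrite (pairing_unit (g := cut_sum p (fun _ : 'I_1 => a) C one_vertex)); last first.
  move=> U U0; congr (cut_sum _ _ _ _); apply/ffunP=> j.
  by rewrite [j]ord1 U0 ffunE.
rewrite /cut_sum.
have supp : support (collapse C) = C.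
  by apply/setP=> v; rewrite inE ffunE; case: (v \in C).
have uniq (c : {ffun V -> option 'I_1}) : support c = C -> c = collapse C.
  move=> <-; apply/ffunP=> v; rewrite !ffunE inE.
  by case: (c v) => //= j; rewrite [j]ord1.
have blockC : block (collapse C) ord0 = C.
  by apply/setP=> v; rewrite inE ffunE; case: (v \in C).
have [aC|aC] := eqVneq (a C) 0.
  rewrite big1 ?aC // => c /andP[/eqP /uniq -> _].
  by rewrite big_ord_recl big_ord0 blockC aC mul0r.
rewrite (big_pred1 (collapse C)); first by rewrite big_ord_recl big_ord0 blockC mulr1.
move=> c; apply/andP/eqP => [[/eqP/uniq //]|->]; rewrite supp eqxx.
by split=> //; apply/asboolP; exact: conn.
Qed.

Lemma connected_eval n (x : PreLie n) a : connected_support (ev _ x a).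
Proof.
move=> C; rewrite ffunE => neq0.
have [T /existsP[c /andP[/eqP suppc /asboolP cT]]] : exists T : rtree 'I_n,
    [exists c, (support c == C) && `[< contracts p c (val T) >]].
  apply/existsP; apply: contraNT neq0 => /existsPn no; apply/eqP.
  apply: big1 => T _; rewrite /cut_sum big_pred0 ?mulr0 // => c.
  by apply/negbTE; have := no T => /existsPn/(_ c).
have [r rP] := rtree_root T; have [v [cv pv _ uniq]] := cT r.
have inC w : (w \in C) = c w by rewrite -suppc inE.
move=> j; rewrite [j]ord1; exists v; rewrite ffunE inC cv ffunE; split=> //.
  move: pv; rewrite (rP r).2 //; case: (p v) => //= u.
  by rewrite ffunE inC => ->.
move=> w; rewrite ffunE inC; case cw: (c w) => [k|] // _ pw.
have pw' : obind c (p w) = None.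
  by move: pw; case: (p w) => //= u; rewrite ffunE inC; case: (c u).
have [u [cu pu neu uniqk]] := cT k.
have wu : w = u by apply: uniqk => //; rewrite pw'.
apply: uniq; last by rewrite pw'.
by rewrite cw; congr Some; apply/rP; rewrite -pu -wu.
Qed.

Lemma connected_act x a : connected_support (act x a).
Proof.
move=> C; rewrite sum_ffunE => neq0.
have [n] : exists n : 'I_#|V|, evc ev (x n) a C != 0.
  apply/existsP; apply: contraNT neq0 => /existsPn no; apply/eqP.
  by apply: big1 => n _; apply/eqP; rewrite -[_ == _]negbK no.
exact: connected_eval.
Qed.

Lemma act_unit a : (0 < #|V|)%N -> connected_support a ->
  act (unit_completion PreLie) a = a.
Proof.
move=> V_gt0 conn; rewrite /act (bigD1 (Ordinal V_gt0)) //= big1 ?addr0.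
  exact: evc_unit.
move=> n; rewrite -val_eqE /= => n_neq0.
by rewrite /unit_completion evc_class_in /= eqSS eq_sym (negPf n_neq0).
Qed.

(** Evaluated at this function, only the cuttings into single vertices remain,
    and these are the isomorphisms with the given tree. *)
Definition singletons : cut_space V := [ffun C : {set V} => (#|C| == 1%N)%:R].

Lemma connected_singletons :
  (forall v, p v <> Some v) -> connected_support singletons.
Proof.
move=> loop C; rewrite ffunE; case: cards1P => [[v ->] _|]; last by rewrite eqxx.
move=> j; rewrite [j]ord1; exists v; rewrite ffunE inE eqxx ffunE; split=> //.
  case E: (p v) => [u|] //=; rewrite ffunE inE; case: eqP => // uv.
  by case: (loop v); rewrite E uv.
by move=> w; rewrite ffunE inE; case: eqP.
Qed.

End Act.

(** * The monoid and its invertible elements *)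

Lemma singleton_blocks (V J : finType) (c : {ffun V -> option J}) :
  support c = setT -> (forall j, #|block c j| == 1%N) ->
  exists2 f : V -> J, injective f & forall v, c v = Some (f v).
Proof.
move=> supp q.
have full v : {j | c v == Some j}.
  have : v \in support c by rewrite supp inE.
  by rewrite inE; case: (c v) => // j _; exists j.
exists (fun v => sval (full v)) => [v w E|v]; last exact/eqP/(svalP (full v)).
have /cards1P[u Bu] := q (sval (full v)).
have : v \in block c (sval (full v)) by rewrite inE (svalP (full v)).
have : w \in block c (sval (full v)) by rewrite E inE (svalP (full w)).
by rewrite Bu !inE => /eqP-> /eqP->.
Qed.

Section Faithful.
Variables (n : nat) (U : rtree 'I_n).

Definition relabeling (s : 'S_n) : {ffun 'I_n -> option 'I_n} :=
  [ffun v => Some ((s^-1)%g v)].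

Lemma relabeling_inj : injective relabeling.
Proof.
move=> s t /ffunP E; apply: (can_inj invgK); apply/permP => v.
by have := E v; rewrite !ffunE => -[].
Qed.

Lemma contracts_relabeling (T : rtree 'I_n) (s : 'S_n) :
  contracts (val U) (relabeling s) (val T) <-> tree_iso s (val T) (val U).
Proof.
have obindE (o : option 'I_n) : obind (relabeling s) o = omap (s^-1)%g o.
  by case: o => //= v; rewrite ffunE.
split=> [cT j|iso j].
  have [v []] := cT j; rewrite ffunE obindE => -[vj] <- _ _.
  have -> : v = s j by rewrite -vj permKV.
  by case: (val U _) => //= u; rewrite permKV.
exists (s j); rewrite ffunE permK obindE iso; split=> //.
- by case: (val T j) => //= k; rewrite permK.
- exact: rtree_loopless.
by move=> w; rewrite ffunE => -[<-] _; rewrite permKV.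
Qed.

(** A cutting of U into single vertices is a relabeling of U. *)
Lemma singleton_cuts (T : rtree 'I_n) :
  cut_sum (val U) (fun _ : 'I_n => singletons 'I_n) [set: 'I_n] (val T) =
  \sum_(s : 'S_n) tree_vec (val T) s U.
Proof.
pose Q (c : {ffun 'I_n -> option 'I_n}) := [forall j, #|block c j| == 1%N].
pose h' c := odflt 1%g [pick s | relabeling s == c].
have h'K s : h' (relabeling s) = s.
  rewrite /h'; case: pickP => [t /eqP /relabeling_inj //|no].
  by have := no s; rewrite eqxx.
transitivity (\sum_(c : {ffun 'I_n -> option 'I_n} |
    ((support c == setT) && `[< contracts (val U) c (val T) >]) && Q c) (1 : rat)).
  rewrite [RHS]big_mkcondr; apply: eq_bigr => c _.
  case: ifP => [/forallP q|/forallPn[j q]].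
    by rewrite big1 // => j _; rewrite ffunE q.
  by rewrite (bigD1 j) //= ffunE (negPf q) mul0r.
rewrite (reindex_onto relabeling h') /=; last first.
  move=> c /andP[/andP[/eqP supp _] /forallP q].
  have [f inj fP] := singleton_blocks supp q.
  suff <- : relabeling (perm inj)^-1 = c by rewrite h'K.
  by apply/ffunP=> v; rewrite ffunE invgK permE fP.
rewrite [RHS](eq_bigr (fun s : 'S_n =>
    if `[< tree_iso s (val T) (val U) >] then 1 else 0 : rat)); last first.
  move=> s _; rewrite ffunE.
  have -> : [forall v, val U (s v) == omap s (val T v)] =
            `[< tree_iso s (val T) (val U) >].
    by apply/forallP/asboolP => iso v; [apply/eqP; exact: iso | exact/eqP/iso].
  by case: asboolP.
rewrite -big_mkcond; apply: eq_bigl => s; rewrite h'K eqxx andbT.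
have -> : support (relabeling s) = setT.
  by apply/setP=> v; rewrite !inE ffunE.
have -> : Q (relabeling s).
  apply/forallP=> j; apply/cards1P; exists (s j); apply/setP=> v.
  by rewrite !inE ffunE (inj_eq Some_inj) -(inj_eq (@perm_inj _ s)) permKV.
by rewrite eqxx andbT /=; apply/asboolP/asboolP => /contracts_relabeling.
Qed.

(** Summing over all permutations is, up to the factor n!, the projection on the
    invariants, hence it is injective on the coinvariants over the rationals. *)
Lemma evc_singletons (x : PreLie n) :
  evc (cut_action (val U)) (lproj (@coinv_rel PreLie n) x) (singletons _) [set: 'I_n] =
  (\sum_(s : 'S_n) PreLie_act s x) U.
Proof.
rewrite evc_lproj ffunE /pairing.
under eq_bigr => T _ do rewrite singleton_cuts big_distrr /=.
rewrite exchange_big sum_ffunE; apply: eq_bigr => s _ /=.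
by rewrite /PreLie_act sum_ffunE; apply: eq_bigr => T _; rewrite [RHS]ffunE.
Qed.

End Faithful.

Lemma evc_faithful n (z w : coinv PreLie n) :
  (forall U : rtree 'I_n,
     evc (cut_action (val U)) z (singletons _) [set: 'I_n] =
     evc (cut_action (val U)) w (singletons _) [set: 'I_n]) ->
  z = w.
Proof.
move=> zw; apply/eqP; rewrite -subr_eq0.
set d := z - w; rewrite -[d]lreprK.
pose pi := lproj (@coinv_rel PreLie n).
have d0 : \sum_(s : 'S_n) PreLie_act s (lrepr d) = 0.
  apply/ffunP=> U; rewrite -evc_singletons lreprK /d [RHS]ffunE.
  have subE (f g : cut_space 'I_n) C : (f - g) C = f C - g C by rewrite !ffunE.
  by rewrite evcB subE zw subrr.
have : pi (\sum_(s : 'S_n) PreLie_act s (lrepr d)) = n`!%:R *: pi (lrepr d).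
  rewrite /pi linear_sum /= (eq_bigr (fun=> pi (lrepr d))) => [|s _].
    by rewrite sumr_const card_Sn scaler_nat.
  exact: (@lproj_sym PreLie).
rewrite d0 /pi linear0 => /esym /eqP; rewrite scaler_eq0 => /orP[|//].
by rewrite Num.Theory.pnatr_eq0 eqn0Ngt fact_gt0.
Qed.

(** At the full vertex set of a tree with n.+1 vertices, only the component of
    arity n.+1 is seen. *)
Lemma act_faithful (x y : completion PreLie) :
  (forall n (U : rtree 'I_n.+1),
     act (val U) x (singletons _) = act (val U) y (singletons _)) ->
  x = y.
Proof.
move=> xy; apply: functional_extensionality_dep => n; apply: evc_faithful => U.
have top z : act (val U) z (singletons _) [set: 'I_n.+1] =
    evc (cut_action (val U)) (z n) (singletons _) [set: 'I_n.+1].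
  rewrite sum_ffunE.
  have lt_n : (n < #|'I_n.+1|)%N by rewrite card_ord.
  rewrite (bigD1 (Ordinal lt_n)) //= big1 ?addr0 // => k.
  rewrite -val_eqE /= => kn; rewrite ffunE; apply: big1 => T _.
  rewrite /cut_sum big1 ?mulr0 // => c /andP[/eqP supp _].
  apply/eqP/prodf_eq0.
  have [/forallP q|/forallPn[j q]] := boolP [forall j, #|block c j| == 1%N]; last first.
    by exists j => //; rewrite ffunE (negPf q).
  have [f /leq_card le_nk _] := singleton_blocks supp q.
  have : (n.+1 <= k.+1)%N.
    apply: (leq_trans (leq_trans (eq_leq (esym (card_ord n.+1))) le_nk)).
    exact: (eq_leq (card_ord k.+1)).
  have : (k < n.+1)%N := leq_trans (ltn_ord k) (eq_leq (card_ord n.+1)).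
  by move: kn => /eqP; lia.
by rewrite -!top xy.
Qed.

Lemma timesA (x y z : completion PreLie) :
  times x (times y z) = times (times x y) z.
Proof. by apply: act_faithful => n U; rewrite !act_times. Qed.

Lemma singletons_connected n (U : rtree 'I_n) :
  connected_support (val U) (singletons 'I_n).
Proof. by apply: connected_singletons => v; exact: rtree_loopless. Qed.

Lemma unit_times (x : completion PreLie) : times (unit_completion PreLie) x = x.
Proof.
apply: act_faithful => n U; rewrite act_times act_unit ?card_ord //.
exact: connected_act.
Qed.

(** The part of the product which does not involve the component of x of the same
    arity; it is what makes left inverses computable recursively. *)
Definition lower_times (x y : completion PreLie) N : coinv PreLie N.+1 :=
  \sum_(m < N)
    \sum_(n : m.+1.-tuple 'I_N.+1
          | (\sum_(i < m.+1) (tnth n i).+1)%N == N.+1)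
      class_in N.+1
        (gamma (comp_repr x m) [seq comp_repr y (nat_of_ord k) | k <- n]).

(** The component of x of arity N.+1 enters only through the composition of N.+1
    into ones, where it is composed with units. *)
Lemma times_lower (x y : completion PreLie) N :
  y 0%N = unit_completion PreLie 0 -> times x y N = x N + lower_times x y N.
Proof.
move=> y0; rewrite /times big_ord_recr /= addrC; congr (_ + _).
rewrite (big_pred1 [tuple of nseq N.+1 ord0]) => [|n]; last first.
  apply/eqP/eqP => [sum_n|->]; last first.
    by rewrite (eq_bigr (fun=> 1%N)) ?sum1_card ?card_ord // => i _; rewrite tnth_nseq.
  apply: eq_from_tnth => i; rewrite tnth_nseq; apply: val_inj => /=.
  move: sum_n; under eq_bigr do rewrite -addn1.
  rewrite big_split /= sum1_card card_ord -[RHS]add0n => /addIn /eqP.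
  by rewrite sum_nat_eq0 => /forallP/(_ i)/eqP.
apply: evc_faithful => U; rewrite evc_class_in.
have -> : [seq comp_repr y (nat_of_ord k) | k <- nseq N.+1 (ord0 : 'I_N.+1)] =
    [seq comp_repr y k | k <- nseq N.+1 0%N] by rewrite !map_nseq.
rewrite tag_gamma_repr ?size_nseq // evt_gamma_repr ?size_nseq //.
have -> : (\sum_(k <- nseq N.+1 0) k.+1)%N = N.+1.
  by rewrite big_nseq iter_addn_0 mul1n.
rewrite eqxx; apply: (congr1 (fun f : cut_space _ => f setT)).
rewrite [RHS]/evc; apply: eval_ext => i lt_i.
by rewrite nth_nseq lt_i y0 evc_unit //; exact: singletons_connected.
Qed.

Definition left_inverse_step (y x : completion PreLie) : completion PreLie :=
  fun N => unit_completion PreLie N - lower_times x y N.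

Lemma lower_times_eq x x' y N : (forall m, (m < N)%N -> x m = x' m) ->
  lower_times x y N = lower_times x' y N.
Proof.
move=> xx'; apply: eq_bigr => m _; apply: eq_bigr => n _.
by rewrite /comp_repr xx'.
Qed.

(** [left_inverse_step] has a unique fixed point, because its component in arity
    N.+1 depends on lower components only: iterating N.+1 times, from any start,
    stabilizes that component. *)
Lemma has_left_inverse (y : completion PreLie) :
  y 0%N = unit_completion PreLie 0 ->
  exists2 x, times x y = unit_completion PreLie & x 0%N = unit_completion PreLie 0.
Proof.
move=> y0; pose app k := iter k (left_inverse_step y) (fun=> 0).
have stable N k : (N < k)%N -> app k N = app N.+1 N.
  elim/ltn_ind: N k => N IHN [//|k] lt_Nk.
  rewrite /app !iterS /left_inverse_step; congr (_ - _).
  apply: lower_times_eq => m lt_mN.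
  by rewrite -!/(app _) !(IHN m) // (leq_trans lt_mN).
pose x : completion PreLie := fun N => app N.+1 N.
exists x; last by rewrite /x /app /= /left_inverse_step /lower_times big_ord0 subr0.
apply: functional_extensionality_dep => N; rewrite times_lower // {1}/x /app iterS.
rewrite {1}/left_inverse_step -addrA addrC -[RHS]add0r; congr (_ + _).
apply/eqP; rewrite addrC subr_eq0; apply/eqP; apply: lower_times_eq => m lt_mN.
by rewrite /x -!/(app _) [RHS]stable.
Qed.

(** If y x = 1 and z y = 1, then x y = z y x y = z y = 1. *)
Lemma in_group_of_unit (x : completion PreLie) :
  x 0%N = unit_completion PreLie 0 -> in_group x.
Proof.
move=> /has_left_inverse[y yx /has_left_inverse[z zy _]]; exists y; split=> //.
by rewrite -[times x y]unit_times -{1}zy -timesA (timesA y) yx unit_times.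
Qed.

Lemma exp_star_in_group : in_group exp_star.
Proof.
apply: in_group_of_unit; rewrite /exp_star invr1 scale1r.
by rewrite /unit_completion /class_in /untag; case: eqP => // E; rewrite (eq_axiomK E).
Qed.

(** * Linear trees *)

(** Linearity for parent maps which are not yet known to be trees, as insertions
    and graftings. *)
Definition linear_parent (V : finType) (p : {ffun V -> option V}) : Prop :=
  forall a b c, p a = Some c -> p b = Some c -> a = b.

Lemma linear_treeP (V : finType) (T : rtree V) :
  reflect (linear_parent (val T)) (linear_tree T).
Proof.
apply: (iffP forallP) => [lin a b c Ta Tb|lin i].
  have /card_le1_eqP/(_ (exist _ a (introT eqP Ta)) (exist _ b (introT eqP Tb))) := lin c.
  by move=> /(_ isT isT) /(congr1 val).
apply/card_le1_eqP => -[a Ta] [b Tb] _ _; apply: val_inj => /=.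
exact: (lin _ _ _ (eqP Tb) (eqP Ta)).
Qed.

Lemma linear_parent_iso (V W : finType) (h : V -> W) p q :
  bijective h -> tree_iso h p q -> linear_parent q <-> linear_parent p.
Proof.
move=> [g hK gK] iso; split=> lin a b c.
  move=> pa pb; apply: (can_inj hK); apply: (lin _ _ (h c)); rewrite iso.
    by rewrite pa.
  by rewrite pb.
rewrite -[a]gK -[b]gK !iso; case pa: (p (g a)) => [u|] //= [uc].
case pb: (p (g b)) => [w|] //= [wc]; congr h; apply: (lin _ _ _ pa _).
by rewrite pb; congr Some; apply: (can_inj hK); rewrite uc wc.
Qed.

(** In a linear tree the depth is injective.  Since all smaller depths also occur,
    it takes values below the number of vertices, hence is a bijection. *)
Lemma linear_depth (V : finType) (T : rtree V) : linear_parent (val T) ->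
  exists e : V -> 'I_#|V|, bijective e /\
    forall v, if val T v is Some u then nat_of_ord (e v) = (e u).+1
              else nat_of_ord (e v) = 0%N.
Proof.
move=> lin; have /rtreeP[r [d0 [rP dP]]] := valP T.
pose d v := (d0 v - d0 r)%N.
have dmin v : (d0 r <= d0 v)%N.
  have [n] := ubnP (d0 v); elim: n v => // n IHn v lt_n.
  case Tv: (val T v) => [u|]; last by move/rP: Tv => ->.
  have := dP _ _ Tv => E; apply: leq_trans (IHn u _) _; lia.
have dS v u : val T v = Some u -> d v = (d u).+1.
  by move=> /dP E; rewrite /d E subSn.
have d_inj : injective d.
  move=> v w; have [n] := ubnP (d v); elim: n v w => // n IHn v w lt_n.
  case Tv: (val T v) => [u|]; case Tw: (val T w) => [t|].
  - rewrite (dS _ _ Tv) (dS _ _ Tw) => -[] /IHn ut; apply: (lin _ _ _ Tv _).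
    by rewrite Tw ut //; move: lt_n; rewrite (dS _ _ Tv).
  - by rewrite (dS _ _ Tv); move/rP: Tw => ->; rewrite /d subnn.
  - by rewrite (dS _ _ Tw); move/rP: Tv => ->; rewrite /d subnn.
  by move/rP: Tv => ->; move/rP: Tw => ->.
have closed k v : (k <= d v)%N -> exists w, d w = k.
  have [n] := ubnP (d v); elim: n v => // n IHn v lt_n.
  rewrite leq_eqVlt => /predU1P[->|]; first by exists v.
  case Tv: (val T v) => [u|]; last by move/rP: Tv => ->; rewrite /d subnn.
  by move: lt_n; rewrite (dS _ _ Tv) !ltnS; exact: IHn.
have bound v : (d v < #|V|)%N.
  have := @uniq_leq_size _ _ [seq d w | w <- enum V] (iota_uniq 0 (d v).+1).
  rewrite size_iota size_map -cardE; apply.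
  move=> k; rewrite mem_iota add0n ltnS => /closed[w <-].
  by apply: map_f; rewrite mem_enum.
exists (fun v => Ordinal (bound v)); split=> [|v] /=.
  by apply: inj_card_bij; [move=> v w /(congr1 val); exact: d_inj | rewrite card_ord].
by case Tv: (val T v) => [u|]; [exact: dS | move/rP: Tv => ->; rewrite /d subnn].
Qed.

Definition leaf (V : finType) (p : {ffun V -> option V}) (v : V) : Prop :=
  forall u, p u <> Some v.

(** The leaf is the vertex of largest depth: any other vertex has the depth of a
    parent, and depth determines vertices. *)
Lemma linear_leaf (V : finType) (T : rtree V) : linear_parent (val T) ->
  exists l, forall v, leaf (val T) v <-> v = l.
Proof.
move=> /linear_depth[e [[g eK gK] eP]].
have [r _] := rtree_root T.
have V_gt0 : (0 < #|V|)%N by apply/card_gt0P; exists r.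
have lt_l : (#|V|.-1 < #|V|)%N by rewrite prednK.
exists (g (Ordinal lt_l)) => v; split=> [leaf_v|-> u].
  rewrite -[v]eK; congr g; apply: val_inj => /=; apply/eqP.
  apply: contraT => ne_v.
  have lt_v' : ((e v).+1 < #|V|)%N.
    rewrite ltn_neqAle (ltn_ord (e v)) andbT; apply: contraNneq ne_v => E.
    by apply/eqP/succn_inj; rewrite prednK.
  have := eP (g (Ordinal lt_v')); rewrite gK.
  case E: (val T _) => [u|] //= [/val_inj/(can_inj eK) vu].
  by case: (leaf_v (g (Ordinal lt_v'))); rewrite E vu.
move=> Tu; have := eP u; rewrite Tu gK /= prednK // => E.
by have := ltn_ord (e u); rewrite E ltnn.
Qed.

(** In a linear insertion the children of i are attached to vertices of S without
    child in S.  If S is linear these are all the leaf of S, so that two children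
    of i would get the same parent. *)
Lemma linear_insertion (V W : finType) (T : rtree V) (i : V) (S : rtree W)
    (f : {ffun incoming T i -> W}) :
  linear_parent (insertion S f) <->
  [/\ linear_parent (val T), linear_parent (val S) &
      forall e, leaf (val S) (f e)].
Proof.
have [s sP] := rtree_root S.
split=> [lin|[linT linS leaves]].
  have linS : linear_parent (val S).
    move=> a b c Sa Sb; have := lin (inr a) (inr b) (inr c).
    by rewrite !insertion_inner Sa Sb => /(_ erefl erefl) [].
  have leaves e : leaf (val S) (f e).
    move=> u Su; have := lin (inr u) (inl (Sub (val e) (incoming_neq e))) (inr (f e)).
    by rewrite insertion_inner Su insertion_edge => /(_ erefl erefl).
  split=> // a b c Ta Tb.
  have [l lP] := linear_leaf linS.
  have [ci|ci] := eqVneq c i.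
    have [ea Ea] : exists e : incoming T i, val e = a.
      by apply: incoming_exists; rewrite Ta ci.
    have [eb Eb] : exists e : incoming T i, val e = b.
      by apply: incoming_exists; rewrite Tb ci.
    have := lin (inl (Sub (val ea) (incoming_neq ea)))
                (inl (Sub (val eb) (incoming_neq eb))) (inr l).
    rewrite !insertion_edge.
    rewrite ((lP _).1 (leaves ea)) ((lP _).1 (leaves eb)) => /(_ erefl erefl) [].
    by rewrite Ea Eb.
  (* When i itself is a child of c, the root of S becomes a child of c. *)
  pose emb v : insertion_vertex W i :=
    if outer_vertex W i v is Some a' then a' else inr s.
  have emb_inj : injective emb.
    move=> v w; rewrite /emb; case: outer_vertexP => [->|j ->];
      case: outer_vertexP => [->|j' ->] //.
    by case=> ->.
  have embT v : val T v = Some c -> insertion S f (emb v) = outer_vertex W i c.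
    move=> Tv; rewrite /emb; case: outer_vertexP => [vi|j vj].
      by rewrite insertion_inner (sP s).2 // -vi Tv.
    by rewrite insertion_outer -?vj Tv //; apply: contraNneq ci => -[->].
  apply: emb_inj; have := embT _ Ta; have := embT _ Tb.
  case: outer_vertexP => [E|j _]; first by rewrite E eqxx in ci.
  by move=> Eb Ea; exact: (lin _ _ _ Ea Eb).
have child a c : insertion S f a = Some c ->
    match a, c with
    | inl j, inl c' => val T (val j) = Some (val c')
    | inl j, inr k => val T (val j) = Some i /\ leaf (val S) k
    | inr k, inl c' => k = s /\ val T i = Some (val c')
    | inr k, inr k' => val S k = Some k'
    end.
  case: a => [j|k].
    have [Tj|Tj] := eqVneq (val T (val j)) (Some i).
      have [e ej] := incoming_exists Tj.
      by rewrite (insertion_incoming _ _ ej) => -[<-].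
    rewrite insertion_outer //; case: (val T (val j)) => [u|] //=.
    by case: outer_vertexP => // c' -> [<-].
  rewrite insertion_inner; case Sk: (val S k) => [k'|]; first by move=> [<-].
  case: (val T i) => [u|] //=; case: outer_vertexP => // c' -> [<-].
  by split=> //; exact/sP.
move=> a b c /child Ha /child Hb; move: a b c Ha Hb.
case=> [j|k] [j'|k'] [c|c].
- by move=> Tj Tj'; congr inl; apply: val_inj; exact: (linT _ _ _ Tj Tj').
- by move=> [Tj _] [Tj' _]; congr inl; apply: val_inj; exact: (linT _ _ _ Tj Tj').
- by move=> Tj [_ Ti]; case/eqP: (valP j); exact: (linT _ _ _ Tj Ti).
- by move=> [_ lf] /lf.
- by move=> [_ Ti] Tj; case/eqP: (valP j'); exact: (linT _ _ _ Tj Ti).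
- by move=> Sk [_ /(_ _ Sk)].
- by move=> [-> _] [-> _].
by move=> Sk Sk'; congr inr; exact: (linS _ _ _ Sk Sk').
Qed.

Lemma linear_grafting (V W : finType) (S : rtree V) (s : V) (T : rtree W) :
  linear_parent (grafting S s T) <->
  [/\ linear_parent (val S), linear_parent (val T) & leaf (val S) s].
Proof.
have [t tP] := rtree_root T.
have gl v : grafting S s T (inl v) = omap inl (val S v) by rewrite ffunE.
have gr w : grafting S s T (inr w) =
    if val T w is Some w' then Some (inr w') else Some (inl s) by rewrite ffunE.
split=> [lin|[linS linT leaf_s]].
  split=> [a b c Sa Sb|a b c Ta Tb|u Su].
  - by have := lin (inl a) (inl b) (inl c); rewrite !gl Sa Sb => /(_ erefl erefl) [].
  - by have := lin (inr a) (inr b) (inr c); rewrite !gr Ta Tb => /(_ erefl erefl) [].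
  have := lin (inl u) (inr t) (inl s); rewrite gl gr Su (tP t).2 //.
  by move=> /(_ erefl erefl).
move=> [a|a] [b|b] [c|c]; rewrite ?gl ?gr.
- case Sa: (val S a) => [a'|] //= [<-]; case Sb: (val S b) => [b'|] //= [ba].
  by congr inl; apply: (linS _ _ _ Sa _); rewrite Sb ba.
- by case: (val S a).
- case Sa: (val S a) => [a'|] //= [<-]; case: (val T b) => // -[sa].
  by case: (leaf_s a); rewrite Sa sa.
- by case: (val S a).
- case Ta: (val T a) => // -[<-]; case Sb: (val S b) => [b'|] //= [bs].
  by case: (leaf_s b); rewrite Sb bs.
- by case: (val S b); case: (val T a).
- case Ta: (val T a) => // _; case Tb: (val T b) => // _.
  by congr inr; move/tP: Ta => ->; move/tP: Tb => ->.
case Ta: (val T a) => [a'|] // [<-]; case Tb: (val T b) => [b'|] // [ba].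
by congr inr; apply: (linT _ _ _ Ta _); rewrite Tb ba.
Qed.

(** * The weight of the linear trees *)

(** The functional lambda: the coefficient of the linear tree in the
    coinvariants. *)
Definition linear_weight n (x : PreLie n) : rat^o :=
  pairing (fun T => (linear_tree T)%:R) x.

Lemma linear_weight_iso (V W : finType) (h : V -> W) p (U : rtree W) (b : bool) :
  bijective h -> tree_iso h p (val U) -> (linear_parent p <-> b) ->
  (linear_tree U)%:R = b%:R :> rat.
Proof.
move=> bij_h iso pb; congr (_%:R); congr (nat_of_bool _); apply/idP/idP.
  by move=> /linear_treeP /(linear_parent_iso bij_h iso) /pb.
by move=> /pb /(linear_parent_iso bij_h iso) /linear_treeP.
Qed.

Lemma linear_weight_act n (s : 'S_n) (x : PreLie n) :
  linear_weight (sym_act s x) = linear_weight x.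
Proof.
apply: pairing_act => T U iso; apply: (linear_weight_iso _ iso).
  exact: perm_bij.
by split=> /linear_treeP.
Qed.

Lemma sum_mul_pairing (I J : finType) (x : I -> rat) (y : J -> rat)
    (F : I -> rat) (G : J -> rat) :
  \sum_i \sum_j (x i * y j) * (F i * G j) =
  (\sum_i x i * F i) * (\sum_j y j * G j).
Proof.
rewrite big_distrlr /=; apply: eq_bigr => i _; apply: eq_bigr => j _.
by rewrite mulrACA.
Qed.

(** Among the maps f, only the constant map to the leaf of S gives a linear
    tree. *)
Lemma linear_weight_circ m n (x : PreLie m.+1) (i : 'I_m.+1) (y : PreLie n) :
  linear_weight (circ x i y) = linear_weight x * linear_weight y.
Proof.
rewrite /linear_weight (pairing_circ (g := fun i T S f =>
   `[< linear_parent (insertion S f) >]%:R)); last first.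
  move=> T S f U iso; apply: (linear_weight_iso _ iso).
    exact: insertion_label_bij.
  by split=> /asboolP.
rewrite -sum_mul_pairing; apply: eq_bigr => T _; apply: eq_bigr => S _.
congr (_ * _); rewrite -natrM mulnb.
case: (linear_treeP T) => [linT|nlT]; last first.
  rewrite big1 // => f _; case: asboolP => // /linear_insertion[] //.
case: (linear_treeP S) => [linS|nlS]; last first.
  rewrite big1 // => f _; case: asboolP => // /linear_insertion[] //.
have [l lP] := linear_leaf linS.
rewrite (bigD1 [ffun=> l]) //= big1 ?addr0.
  case: asboolP => // -[]; apply/linear_insertion; split=> // e.
  by rewrite ffunE; apply/lP.
move=> f; case: asboolP => // /linear_insertion[_ _ leaves] /eqP[].
by apply/ffunP=> e; rewrite ffunE; apply/lP.
Qed.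

(** Among the vertices of S, only the leaf gives a linear tree. *)
Lemma linear_weight_product m n (x : PreLie m) (y : PreLie n) :
  linear_weight (labeled_prelie_product x y) = linear_weight x * linear_weight y.
Proof.
rewrite /linear_weight (pairing_product (g := fun S T s =>
   `[< linear_parent (grafting S s T) >]%:R)); last first.
  move=> S T s U iso; apply: (linear_weight_iso _ iso).
    exact: grafting_label_bij.
  by split=> /asboolP.
rewrite -sum_mul_pairing; apply: eq_bigr => S _; apply: eq_bigr => T _.
congr (_ * _); rewrite -natrM mulnb.
case: (linear_treeP S) => [linS|nlS]; last first.
  rewrite big1 // => f _; case: asboolP => // /linear_grafting[] //.
case: (linear_treeP T) => [linT|nlT]; last first.
  rewrite big1 // => f _; case: asboolP => // /linear_grafting[] //.
have [l lP] := linear_leaf linS.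
rewrite (bigD1 l) //= big1 ?addr0.
  by case: asboolP => // -[]; apply/linear_grafting; split=> //; apply/lP.
by move=> s; case: asboolP => // /linear_grafting[_ _ /lP ->]; rewrite eqxx.
Qed.

Lemma linear_weight_unit : linear_weight PreLie_unit = 1.
Proof.
apply: pairing_unit => U _; case: linear_treeP => // -[] a b c.
by rewrite [a]ord1 [b]ord1.
Qed.

(** PreLie acts on the rationals through its quotient As, the rationals being a
    commutative associative algebra. *)
Definition linear_eval n (x : PreLie n) (a : nat -> rat^o) : rat^o :=
  linear_weight x * \prod_(i < n) a i.

Lemma linear_eval_linear n a : linear (fun x : PreLie n => linear_eval x a).
Proof.
by move=> k x y; rewrite /linear_eval /linear_weight linearP mulrDl -scalerAl.
Qed.

Lemma linear_eval_ext n (x : PreLie n) a b :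
  (forall i, (i < n)%N -> a i = b i) -> linear_eval x a = linear_eval x b.
Proof.
by move=> ab; congr (_ * _); apply: eq_bigr => i _; rewrite ab.
Qed.

Lemma linear_eval_sym n (s : 'S_n) (x : PreLie n) a :
  linear_eval (sym_act s x) (fun=> a) = linear_eval x (fun=> a).
Proof. by rewrite /linear_eval linear_weight_act. Qed.

Lemma linear_eval_circ m n (x : PreLie m.+1) (i : 'I_m.+1) (y : PreLie n) a :
  linear_eval (circ x i y) a =
    linear_eval x (insert_arg i n (linear_eval y (fun k => a (i + k)%N)) a).
Proof.
rewrite /linear_eval linear_weight_circ -mulrA; congr (_ * _).
have [g gK Kg] := insertion_label_bij n i.
rewrite (reindex (@insertion_label m n i)) /=; last by exists g => ? _.
rewrite big_sumType /= [RHS](bigD1 i) //= /insert_arg ltnn eqxx.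
rewrite big_neq_sub -mulrA; congr (_ * _); rewrite mulrC; congr (_ * _).
apply: eq_bigr => j _ /=.
have ne : (val j : nat) <> i by move=> /val_inj ji; case/eqP: (valP j).
by case: (ltngtP (val j) i).
Qed.

Definition linear_action : operad_action PreLie rat^o :=
  OperadAction linear_eval_linear linear_eval_ext linear_eval_sym linear_eval_circ.

Definition linear_coef n (z : coinv PreLie n) : rat := evc linear_action z 1.

Lemma linear_coef_lproj n (x : PreLie n) :
  linear_coef (lproj (@coinv_rel PreLie n) x) = linear_weight x.
Proof. by rewrite /linear_coef evc_lproj /= /linear_eval big1 ?mulr1. Qed.

Lemma linear_coef_lrepr n (z : coinv PreLie n) :
  linear_coef z = linear_weight (lrepr z).
Proof. by rewrite -linear_coef_lproj lreprK. Qed.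

Lemma linear_coef_product m n (x : coinv PreLie m) (y : coinv PreLie n) :
  linear_coef (prelie_product x y) = linear_coef x * linear_coef y.
Proof.
by rewrite linear_coef_lproj linear_weight_product -!linear_coef_lrepr.
Qed.

Lemma linear_coef_power k : linear_coef (prelie_power k) = 1.
Proof.
elim: k => [|k IHk]; first by rewrite linear_coef_lproj linear_weight_unit.
apply: etrans (linear_coef_product (prelie_power k) prelie_generator) _.
by rewrite IHk linear_coef_lproj linear_weight_unit mulr1.
Qed.

Lemma linear_coef_exp n : linear_coef (exp_star n) = (n.+1)`!%:R^-1.
Proof.
have := evc_linear linear_action 1 ((n.+1)`!%:R^-1) (prelie_power n) 0.
rewrite addr0 evc0 addr0 /exp_star /linear_coef => ->.
by rewrite -/(linear_coef _) linear_coef_power /GRing.scale /= mulr1.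
Qed.

Lemma linear_coef_unit n : linear_coef (unit_completion PreLie n) = (n == 0%N)%:R.
Proof.
rewrite /linear_coef /unit_completion evc_class_in /= eqSS eq_sym.
case: eqP => // _.
by rewrite /evt /= /linear_eval linear_weight_unit big1 ?mulr1.
Qed.

(** This is the coefficient of degree N.+1 of the composition of the two series
    with coefficients [linear_coef (x n)] and [linear_coef (y n)] in degree
    n.+1. *)
Lemma linear_coef_times (x y : completion PreLie) N :
  linear_coef (times x y N) =
    \sum_(m < N.+1) linear_coef (x m) *
      \sum_(n : m.+1.-tuple 'I_N.+1
            | (\sum_(i < m.+1) (tnth n i).+1)%N == N.+1)
        \prod_(i < m.+1) linear_coef (y (nth 0%N [seq nat_of_ord k | k <- n] i)).
Proof.
rewrite /linear_coef evc_times; apply: eq_bigr => m _.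
rewrite big_distrr /=; apply: eq_bigr => n _.
by rewrite -/(linear_coef _) linear_coef_lrepr.
Qed.

(** * The coefficients of the logarithm *)

(** The sum over compositions which defines the product is thus a coefficient of
    a power; the terms of degree above K do not matter for it. *)
Lemma coef_comp_power (l : nat -> rat) m N K : (N < K)%N ->
  ((\sum_(k < K) l k *: 'X^(k.+1)) ^+ m)`_N.+1 =
  \sum_(n : m.-tuple 'I_N.+1 | (\sum_(i < m) (tnth n i).+1)%N == N.+1)
    \prod_(i < m) l (nth 0%N [seq nat_of_ord k | k <- n] i).
Proof.
move=> lt_NK.
rewrite (sum_compositions _ (fun s => \prod_(i < m) l (nth 0%N s i)) lt_NK).
rewrite -[m in LHS]card_ord -prodr_const bigA_distr_bigA coef_sum [RHS]big_mkcond /=.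
apply: eq_bigr => f _; rewrite scaler_prod prodrXr coefZ coefXn.
rewrite eq_sym; case: eqP => _; last by rewrite mulr0.
by rewrite mulr1; apply: eq_bigr => i _; rewrite nth_ffun_seq.
Qed.

(** Comparison of the coefficients of degree N in L' (1 + x) = 1, where the
    hypothesis says that exp L = 1 + x up to degree N.+1.  Exponentials are
    truncated: F and E stop at the powers N.+1 and N of L, and F' = L' E.  Both
    agree with exp L in the degrees of interest, since L^m starts in degree m. *)
Lemma log_recurrence (l : nat -> rat) N :
  (forall j, (j <= N)%N ->
    \sum_(m < j.+1) (m.+1)`!%:R^-1 *
      (\sum_(n : m.+1.-tuple 'I_j.+1
            | (\sum_(i < m.+1) (tnth n i).+1)%N == j.+1)
        \prod_(i < m.+1) l (nth 0%N [seq nat_of_ord k | k <- n] i))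
    = (j == 0%N)%:R) ->
  l N * N.+1%:R + (if N is M.+1 then l M * M.+1%:R else 0) = (N == 0%N)%:R.
Proof.
move=> Hl; pose L : {poly rat} := \sum_(k < N.+1) l k *: 'X^(k.+1).
pose F : {poly rat} := \sum_(m < N.+2) m`!%:R^-1 *: L ^+ m.
pose E : {poly rat} := \sum_(m < N.+1) m`!%:R^-1 *: L ^+ m.
have coefL k : (k <= N)%N -> L`_k.+1 = l k.
  move=> le_k; have lt_k : (k < N.+1)%N by [].
  rewrite coef_sum (bigD1 (Ordinal lt_k)) //= coefZ coefXn eqxx mulr1.
  rewrite big1 ?addr0 // => j /eqP jk; rewrite coefZ coefXn eqSS.
  by case: eqP => [kj|_]; [case: jk; apply: val_inj | rewrite mulr0].
have low m j : (j < m)%N -> (L ^+ m)`_j = 0.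
  move=> lt_jm; have -> : L = 'X * \sum_(k < N.+1) l k *: 'X^k.
    by rewrite mulr_sumr; apply: eq_bigr => k _; rewrite -scalerAr exprS.
  by rewrite exprMn coefXnM lt_jm.
have coefF j : (j <= N.+1)%N -> F`_j = (1 + 'X)`_j.
  case: j => [|j] le_j; rewrite coefD coef1 coefX coef_sum /=.
    rewrite big_ord_recl big1 => [|m _].
      by rewrite expr0 coefZ coef1 fact0 !addr0 invr1.
    by rewrite coefZ low ?mulr0.
  rewrite add0r eqSS -(Hl j le_j) big_ord_recl expr0 coefZ coef1 mulr0 add0r.
  rewrite [RHS](big_ord_widen N.+1 (fun m => (m.+1)`!%:R^-1 *
      (\sum_(n : m.+1.-tuple 'I_j.+1
            | (\sum_(i < m.+1) (tnth n i).+1)%N == j.+1)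
        \prod_(i < m.+1) l (nth 0%N [seq nat_of_ord k | k <- n] i)))) //.
  rewrite [RHS]big_mkcond; apply: eq_bigr => m _ /=; rewrite coefZ /bump leq0n add1n.
  case: ifP => [le_mj|gt_mj]; last by rewrite low ?mulr0 // ltnS ltnNge -ltnS gt_mj.
  by rewrite (coef_comp_power _ _ le_j).
have FE : F^`() = L^`() * E.
  rewrite raddf_sum big_ord_recl /= expr0 derivZ derivC scaler0 add0r mulr_sumr.
  apply: eq_bigr => m _; rewrite /bump leq0n add1n derivZ deriv_exp /= -scalerAr.
  rewrite -scaler_nat scalerA factS natrM invfM mulrAC mulVf ?mul1r //.
  by rewrite Num.Theory.pnatr_eq0.
have coefE j : (j <= N)%N -> E`_j = (1 + 'X)`_j.
  move=> le_j; rewrite -coefF ?(leqW le_j) // /F big_ord_recr /= coefD coefZ.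
  by rewrite low ?ltnS // mulr0 addr0.
have : (L^`() * E)`_N = (N == 0%N)%:R.
  rewrite -FE coef_deriv coefF // coefD coef1 coefX add0r eqSS.
  by case: (N) => [|M]; rewrite ?mul0rn.
rewrite coefM (eq_bigr (fun j : 'I__ => L^`()`_j * (1 + 'X)`_(N - j))); last first.
  by move=> j _; rewrite coefE // leq_subr.
rewrite -coefM mulrDr mulr1 coefD coefMX !coef_deriv coefL // => <-.
rewrite mulr_natr; congr (_ + _); case: (N) coefL => //= M coefL.
by rewrite coefL // mulr_natr.
Qed.

Lemma log_coef (l : nat -> rat) :
  (forall N,
    \sum_(m < N.+1) (m.+1)`!%:R^-1 *
      (\sum_(n : m.+1.-tuple 'I_N.+1
            | (\sum_(i < m.+1) (tnth n i).+1)%N == N.+1)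
        \prod_(i < m.+1) l (nth 0%N [seq nat_of_ord k | k <- n] i))
    = (N == 0%N)%:R) ->
  forall N, l N = log_series N.+1.
Proof.
move=> Hl N; have rec M := @log_recurrence l M (fun j _ => Hl j).
have nz k : k.+1%:R != 0 :> rat by rewrite Num.Theory.pnatr_eq0.
suff : l N * N.+1%:R = (-1) ^+ N by move=> E; rewrite /log_series -E mulfK.
elim: N => [|N IHN]; first by have := rec 0%N; rewrite addr0.
have /eqP := rec N.+1; rewrite IHN addr_eq0 => /eqP ->.
by rewrite exprS mulN1r.
Qed.

(** * The image in the associative operad *)

Section LinearQuotientMap.
Variable n : nat.

Lemma basis_tree_expansion (x : PreLie n) :
  x = \sum_T (x : {ffun _ -> rat^o}) T *: basis_tree T.
Proof.
apply/ffunP=> U; rewrite sum_ffunE (bigD1 U) //= ffunE ffunE eqxx.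
rewrite big1 ?addr0; first by rewrite /GRing.scale /= mulr1.
by move=> T TU; rewrite !ffunE eq_sym (negPf TU) scaler0.
Qed.

Lemma PreLie_act_linear (s : 'S_n) : linear (@PreLie_act n s).
Proof.
move=> k x y; rewrite /PreLie_act scaler_sumr -big_split; apply: eq_bigr => T _.
by rewrite !ffunE scalerDl scalerA.
Qed.

Lemma PreLie_act_basis (s : 'S_n) (T U : rtree 'I_n) :
  tree_iso s (val T) (val U) -> PreLie_act s (basis_tree T) = basis_tree U.
Proof.
move=> iso; rewrite -(tree_vec_iso (perm_bij s) (valP T) iso).
rewrite /PreLie_act (bigD1 T) //= ffunE eqxx scale1r big1 ?addr0 // => T' T'T.
by rewrite ffunE (negPf T'T) scale0r.
Qed.

(** Relabeling preserves the ideal of nonlinear trees, hence commutes with the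
    passage to As. *)
Lemma nonlinear_act (s : 'S_n) (x : PreLie n) :
  in_span (@nonlinear n) x -> in_span (@nonlinear n) (PreLie_act s x).
Proof.
elim=> [|k g v [T [nlT ->]] _ IHv].
  have := PreLie_act_linear s (-1) 0 0.
  by rewrite scaler0 add0r scaleN1r addNr => ->; exact: in_span0.
rewrite PreLie_act_linear; apply: in_spanD => //.
have [U iso E] := tree_vec_basis (perm_bij s) (valP T).
exists U; split.
  apply: contra nlT => /linear_treeP/(linear_parent_iso (perm_bij s) iso) lin.
  exact/linear_treeP.
by rewrite !tree_vec_id; exact: PreLie_act_basis.
Qed.

Definition As_class (x : PreLie n) : coinv As n :=
  lproj (@coinv_rel As n) (quotient_map nonlinear x).

Lemma As_class_is_linear : linear As_class.
Proof. by move=> k u v; rewrite /As_class /quotient_map !linearP. Qed.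

HB.instance Definition _ :=
  GRing.isLinear.Build rat (PreLie n) (coinv As n) _ As_class As_class_is_linear.

Lemma As_class_act (s : 'S_n) (x : PreLie n) :
  As_class (PreLie_act s x) = As_class x.
Proof.
rewrite -[RHS](lproj_sym s); congr (lproj _ _); set y := quotient_map nonlinear x.
rewrite /quotient_map /=; apply/lproj_eqP.
have := PreLie_act_linear s (-1) (lrepr y) x.
rewrite !scaleN1r [RHS]addrC => <-; apply: nonlinear_act; rewrite addrC.
by apply/lproj_eqP; rewrite lreprK.
Qed.

End LinearQuotientMap.

Lemma ladder_rtree n : is_rtree (ladder n).
Proof.
apply: (@rtreeI _ _ ord0 (@nat_of_ord _)) => [v|v u]; rewrite ffunE.
  by split=> [|->//]; case E: (nat_of_ord v) => // _; apply: val_inj.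
case E: (nat_of_ord v) => [//|k] [<-]; rewrite inordK //.
by have := ltn_ord v; lia.
Qed.

(** The relabeling sends k to the vertex of depth k. *)
Lemma linear_ladder n (T : rtree 'I_n.+1) : linear_tree T ->
  exists s : 'S_n.+1, tree_iso s (ladder n) (val T).
Proof.
move=> /linear_treeP/linear_depth[e [[g eK gK] eP]].
have cardn := card_ord n.+1.
pose h (j : 'I_n.+1) := g (cast_ord (esym cardn) j).
have h_inj : injective h by move=> i j /(can_inj gK) /cast_ord_inj.
have depth j : nat_of_ord (e (h j)) = j by rewrite gK.
exists (perm h_inj) => j; rewrite permE ffunE.
have := eP (h j); rewrite depth; case: (val T (h j)) => [u|] -> //=.
congr Some; rewrite permE; apply: (can_inj eK); apply: val_inj.
rewrite [RHS]depth inordK //; have := ltn_ord (e u).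
by rewrite [X in (_ < X)%N]cardn.
Qed.

(** Nonlinear trees die in As, and the linear ones have the class of the ladder in
    the coinvariants.  So only the sum of their coefficients remains. *)
Lemma As_class_linear_weight n (x : PreLie n.+1) :
  As_class x = linear_weight x *: theta n.
Proof.
rewrite {1}(basis_tree_expansion x) linear_sum /linear_weight /pairing.
rewrite scaler_suml; apply: eq_bigr => T _; rewrite linearZ /= -scalerA; congr (_ *: _).
have [linT|nlT] := boolP (linear_tree T).
  have [s iso] := linear_ladder linT.
  pose Lt : rtree 'I_n.+1 := Sub (ladder n) (ladder_rtree n).
  have <- : PreLie_act s (basis_tree Lt) = basis_tree T.
    by apply: PreLie_act_basis; rewrite SubK.
  by rewrite As_class_act -tree_vec_id SubK scale1r.
rewrite scale0r /As_class; have -> : quotient_map nonlinear (basis_tree T) = 0.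
  rewrite /quotient_map -(linear0 (lproj (@nonlinear n.+1))); apply/lproj_eqP.
  by rewrite subr0; apply: in_span_gen; exists T; rewrite tree_vec_id.
exact: linear0.
Qed.

Lemma phi_linear_coef (x : completion PreLie) n :
  phi x n = linear_coef (x n) *: theta n.
Proof. by rewrite linear_coef_lrepr -As_class_linear_weight. Qed.

Theorem proposition7 :
  in_group exp_star /\
  phi exp_star = completion_of_series exp_series /\
  (forall log_star : completion PreLie,
     is_inverse exp_star log_star ->
     phi log_star = completion_of_series log_series).
Proof.
split; first exact: exp_star_in_group.
split=> [|log_star [exp_log _]]; apply: functional_extensionality_dep => n;
  rewrite phi_linear_coef; congr (_ *: _).
  by rewrite linear_coef_exp /exp_series subr0.
apply: (@log_coef (fun k => linear_coef (log_star k))) => N.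
rewrite -linear_coef_unit -exp_log linear_coef_times.
by apply: eq_bigr => m _; rewrite linear_coef_exp.
Qed.
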